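(* Let $T_h$ be a triangle one of whose heights is $h$, and let $X$ be a configuration that is rectangular (or a simplex) with circumradius less than $h$. There exists some $n=n(X,h)$, depending only on $X$ and $h$, such that for any positive integer $r$, $\mathbb{E}^n\overset{r}{\rightarrow}(X;T_h)_{\mathrm{GR}}$. In particular, for any triangle $T_h$ with a height $h$ and with circumradius less than $h$, there exists some $n=n(T_h)$ such that for any positive integer $r$, $\mathbb{E}^n\overset{r}{\rightarrow}(T_h;T_h)_{\mathrm{GR}}$.
   Context: $\mathbb{E}^n$ denotes $n$-dimensional Euclidean space. An $r$-coloring of $\mathbb{E}^n$ is an assignment to each point of one of $r$ colors (not all colors need be used). A set of points is monochromatic if all its points have the same color, and rainbow if its points have pairwise distinct colors. Triangles and simplices are identified with their (finite, affinely independent) vertex sets. A triangle has height $h$ if its vertices can be labelled $\boldsymbol{a},\boldsymbol{b},\boldsymbol{c}$ so that the distance from $\boldsymbol{c}$ to the line $\boldsymbol{ab}$ is $h$. A configuration is rectangular if it is a subset of the vertices of a rectangular parallelepiped (of some dimension). A configuration is spherical if it lies on the surface of a sphere; the circumradius $\rho(X)$ of a spherical set $X$ is the smallest radius among all spheres that contain $X$ as a subset. $\mathbb{E}^n\overset{r}{\rightarrow}(K_1;K_2)_{\mathrm{GR}}$ means that every $r$-coloring of $\mathbb{E}^n$ contains either a monochromatic set congruent (isometric) to $K_1$ or a rainbow set congruent to $K_2$. *)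

(* Defs.v *)
From mathcomp Require Import all_boot all_order all_algebra.
From mathcomp Require Import boolp classical_sets reals.

Set Implicit Arguments.
Unset Strict Implicit.
Unset Printing Implicit Defensive.

Import Order.TTheory GRing.Theory Num.Theory.
Local Open Scope classical_set_scope.
Local Open Scope ring_scope.

(* The norm that MathComp-Analysis puts on 'rV[R]_n is the sup norm, so the
   Euclidean structure is defined here. *)
Definition dotp (R : realType) (n : nat) (u v : 'rV[R]_n) : R :=
  \sum_(i < n) u 0 i * v 0 i.

Definition edist (R : realType) (n : nat) (x y : 'rV[R]_n) : R :=
  Num.sqrt (\sum_(i < n) (x 0 i - y 0 i) ^+ 2).

(* The two sets may live in Euclidean spaces of different dimensions. *)
Definition congruent (R : realType) (d n : nat)
    (X : set 'rV[R]_d) (Y : set 'rV[R]_n) : Prop :=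
  exists2 f : 'rV[R]_d -> 'rV[R]_n,
    f @` X = Y &
    forall x y, X x -> X y -> edist (f x) (f y) = edist x y.

(* Radius 0 is allowed, so that a one-point set has circumradius 0. *)
Definition sphere_radius (R : realType) (d : nat) (X : set 'rV[R]_d) (s : R) :
    Prop :=
  0 <= s /\ exists c : 'rV[R]_d, forall x, X x -> edist c x = s.

(* A set that is not spherical has no circumradius. *)
Definition is_circumradius (R : realType) (d : nat) (X : set 'rV[R]_d)
    (rho : R) : Prop :=
  sphere_radius X rho /\ forall s, sphere_radius X s -> rho <= s.

Definition affinely_independent (R : realType) (d k : nat)
    (p : 'I_k -> 'rV[R]_d) : Prop :=
  forall c : 'I_k -> R,
    \sum_(i < k) c i = 0 -> \sum_(i < k) c i *: p i = 0 -> forall i, c i = 0.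

Definition is_ksimplex (R : realType) (d k : nat) (X : set 'rV[R]_d) : Prop :=
  exists2 p : 'I_k.+1 -> 'rV[R]_d, affinely_independent p & X = range p.

Definition is_simplex (R : realType) (d : nat) (X : set 'rV[R]_d) : Prop :=
  exists k : nat, is_ksimplex k X.

Definition is_triangle (R : realType) (d : nat) (T : set 'rV[R]_d) : Prop :=
  is_ksimplex 2 T.

Definition line (R : realType) (d : nat) (a b : 'rV[R]_d) : set 'rV[R]_d :=
  [set x | exists t : R, x = a + t *: (b - a)].

Definition dist_to_set (R : realType) (d : nat) (c : 'rV[R]_d)
    (L : set 'rV[R]_d) : R :=
  inf [set edist c q | q in L].

Definition has_height (R : realType) (d : nat) (T : set 'rV[R]_d) (h : R) :
    Prop :=
  exists a b c : 'rV[R]_d,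
    T = [set a; b; c] /\ dist_to_set c (line a b) = h.

(* The vertices of the parallelepiped with corner p and edge vectors e. *)
Definition box_vertices (R : realType) (m k : nat) (p : 'rV[R]_m)
    (e : 'I_k -> 'rV[R]_m) : set 'rV[R]_m :=
  range (fun S : {set 'I_k} => p + \sum_(i in S) e i).

Definition rectangular_edges (R : realType) (m k : nat)
    (e : 'I_k -> 'rV[R]_m) : Prop :=
  (forall i, e i != 0) /\ (forall i j, i != j -> dotp (e i) (e j) = 0).

(* The parallelepiped may have larger dimension than the space in which X is
   given: an acute triangle in the plane is rectangular, although it embeds
   only in a three-dimensional box. *)
Definition is_rectangular (R : realType) (d : nat) (X : set 'rV[R]_d) : Prop :=
  exists (m k : nat) (p : 'rV[R]_m) (e : 'I_k -> 'rV[R]_m) (Y : set 'rV[R]_m),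
    [/\ rectangular_edges e, Y `<=` box_vertices p e & congruent X Y].

Definition monochromatic (T : Type) (r : nat) (chi : T -> 'I_r) (K : set T) :
    Prop :=
  forall x y, K x -> K y -> chi x = chi y.

Definition rainbow (T : Type) (r : nat) (chi : T -> 'I_r) (K : set T) : Prop :=
  forall x y, K x -> K y -> chi x = chi y -> x = y.

Definition gr_arrow (R : realType) (n r d1 d2 : nat)
    (K1 : set 'rV[R]_d1) (K2 : set 'rV[R]_d2) : Prop :=
  forall chi : 'rV[R]_n -> 'I_r,
    (exists K : set 'rV[R]_n, congruent K1 K /\ monochromatic chi K) \/
    (exists K : set 'rV[R]_n, congruent K2 K /\ rainbow chi K).

(* Main.v *)
Require Import Defs.
From mathcomp Require Import all_boot all_order all_algebra.
From mathcomp Require Import boolp classical_sets reals.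
From mathcomp Require Import ring lra zify.

Set Implicit Arguments.
Unset Strict Implicit.
Unset Printing Implicit Defensive.
Import Order.TTheory GRing.Theory Num.Theory.

(** Suppose that no copy of [T] is rainbow, and fix the base [a, b] of [T], over which
    the height is [h].  If two points [A] and [B] at the distance of [a] and [b] have
    different colours, every apex completing them to a copy of [T] has one of
    these two colours; the apices contain a sphere of radius [h] lying in a
    hyperplane.  So one only needs a dimension in which every 2-colouring of that
    sphere contains a monochromatic copy of [X], and this dimension does not depend
    on [r] or [T].  If there are no such [A] and [B], a whole hyperplane is
    monochromatic.  This is [sphere_ramsey_gr_arrow].

    It remains to show that [X], whose circumradius is less than [h], has a
    monochromatic copy in every finite colouring of a large finite subset of a
    sphere of radius [h] (the notion [sphere_ramsey], in terms of squared
    distances). There are three sources of such configurations. Regular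
    simplices give small ones by the pigeonhole principle
    ([sphere_ramsey_partition]). Products add squared radii and squared
    distances ([sphere_ramsey_prod]). Finally, Ramsey's theorem applies to
    vectors that arise from a single sequence by inserting zeros
    ([sphere_ramsey_rows]).

    The main point is that vectors of the last kind approximate every finite
    set of points of a sphere, without increasing the radius
    ([sphere_ramsey_approx]). It rests on a sequence with a strong
    self-similarity: [u] consecutive copies of it look, after inserting zeros,
    almost like the sequence multiplied by [sqrt u] ([self_similar_blocks]).
    To build it, put on each level [n] a comb of [n] equally spaced points of
    equal size, with weights of the levels almost invariant under dilation
    ([almost_invariant_weight]); [u] consecutive copies of the comb of level
    [n] form the comb of level [u * n], stretched. For a unit vector [x] with
    [x_l ^+ 2] close to [u_l / Q] and [\sum_l u_l = Q], one distributes [Q]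
    copies of the sequence over blocks of coordinates, [u_l] of them to block
    [l], and gets a vector close to [x].

    The approximation is then made exact, at the price of an arbitrarily small
    increase of the radius.  For a subset of a box the approximating set is again a
    subset of a box, slightly smaller, and each edge is corrected by a product with
    a pair of points ([sphere_ramsey_box]); the centre of the box is replaced by the
    circumcentre of [X].  For a simplex one approximates a simplex whose squared
    edge lengths are all smaller by nearly the same amount; the difference is the
    metric of a nearly regular simplex ([sphere_ramsey_simplex]). *)

(** * Ramsey's theorem for subsets of a fixed size *)

Fixpoint spread (T : Type) (x0 : T) (b : seq bool) (s : seq T) : seq T :=
  match b with
  | [::] => [::]
  | true :: b' => head x0 s :: spread x0 b' (behead s)
  | false :: b' => x0 :: spread x0 b' s
  end.

Lemma size_spread T (x0 : T) b s : size (spread x0 b s) = size b.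
Proof. by elim: b s => [|[] b IH] s //=; rewrite IH. Qed.

Lemma spread_spread T (x0 : T) c b s :
  spread x0 (spread false c b) s = spread x0 c (spread x0 b s).
Proof.
by elim: c b s => [|[] c IH] [|[] b] s //=; rewrite IH.
Qed.

Lemma count_spread c b : size b = count id c ->
  count id (spread false c b) = count id b.
Proof.
elim: c b => [|[] c IH] [|x b] //=; rewrite ?add0n //.
- by move=> [sz]; rewrite IH.
- by move=> sz; rewrite IH.
- by move=> sz; rewrite IH.
Qed.

Lemma count0_eq (m : seq bool) : count id m = 0 -> m = nseq (size m) false.
Proof. by elim: m => [|[] m IH] //=; rewrite add0n => /IH {1}->. Qed.

Lemma exists_submask (d : seq bool) M : M <= count id d ->
  exists d', [/\ size d' = size d, count id d' = M &
    forall i, nth false d' i -> nth false d i].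
Proof.
elim: d M => [|x d IH] M /=.
  by rewrite leqn0 => /eqP ->; exists [::].
case: x; last first.
  rewrite add0n => /IH [d' [sz ct sub]].
  by exists (false :: d'); split=> /=; rewrite ?sz ?add0n // => -[|i] //= /sub.
case: M => [_|M].
  by exists (nseq (size d).+1 false); split;
    rewrite /= ?size_nseq ?count_nseq // => -[|i] //=; rewrite nth_nseq if_same.
rewrite add1n ltnS => /IH [d' [sz ct sub]].
by exists (true :: d'); split=> /=; rewrite ?sz ?ct // => -[|i] //= /sub.
Qed.

Lemma find_spread (d m : seq bool) : size m = count id d -> has id m ->
  nth false d (find id (spread false d m)) /\
  find id (spread false d m) < size d.
Proof.
elim: d m => [|[] d IH] [|x m] //=.
- by case: x => //= -[sz] hm; have [] := IH _ sz hm.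
- by rewrite add0n => sz hm; have [] := IH (x :: m) sz hm.
Qed.

(** Pigeonhole: a map from [k * M] indices to [k] colours is constant on [M]
    of them. *)
Lemma pigeonhole_color (C : finType) (M k : nat) (g : nat -> C) :
  0 < k -> #|C| * M <= k -> exists c : C, M <= count (fun i => g i == c) (iota 0 k).
Proof.
move=> k0 hk; apply/existsP; apply: contraT; rewrite negb_exists => /forallP H.
have tot : \sum_(c : C) count (fun i => g i == c) (iota 0 k) = k.
  rewrite (eq_bigr (fun c => \sum_(i <- iota 0 k | g i == c) 1)); last first.
    by move=> c _; rewrite sum1_count.
  rewrite (exchange_big_dep predT) //= -[RHS](size_iota 0) -sum1_size.
  by apply: eq_bigr => i _; rewrite (big_pred1 (g i)).
have M0 : 0 < M by have := H (g 0); rewrite -ltnNge; exact: leq_ltn_trans.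
have C0 : 0 < #|C| by apply/card_gt0P; exists (g 0).
have : k <= \sum_(c : C) M.-1.
  rewrite -{1}tot; apply: leq_sum => c _.
  by have := H c; rewrite -ltnNge -{1}(prednK M0) ltnS.
rewrite sum_nat_const => hk2; have := leq_trans hk hk2.
by rewrite leq_pmul2l // leqNgt prednK // leqnn.
Qed.

(** A mask of size [N] with [n] ones stands for an [n]-subset of an interval of
    length [N], and [spread false c m] for the subset [m] of the set [c]. *)
Definition homogeneous (n M N : nat) (C : Type) (chi : seq bool -> C)
    (c : seq bool) : Prop :=
  [/\ size c = N, count id c = M &
   forall m m', size m = M -> size m' = M -> count id m = n -> count id m' = n ->
     chi (spread false c m) = chi (spread false c m')].

(** The inductive step of Ramsey's theorem: a large set on which the colour of a
    subset depends on its least element only. *)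
Lemma end_homogeneous (n k : nat) (C : finType) :
  (forall M, exists N, forall chi : seq bool -> C,
     exists c, homogeneous n M N chi c) ->
  exists N, forall chi : seq bool -> C, exists c (g : nat -> C),
    [/\ size c = N, count id c = k &
     forall m, size m = k -> count id m = n.+1 ->
       chi (spread false c m) = g (find id m)].
Proof.
move=> ram; elim: k => [|k [Nk IH]].
  by exists 0 => chi; exists [::], (fun=> chi [::]); split=> // -[].
have [N' HN'] := ram Nk; exists N'.+1 => chi.
have [c1 [sz1 ct1 hom]] := HN' (fun m => chi (true :: m)).
have [c2 [g [sz2 ct2 hg]]] := IH (fun m => chi (false :: spread false c1 m)).
pose m0 := nseq n true ++ nseq (k - n) false.
exists (true :: spread false c1 c2),
  (fun i => if i is j.+1 then g j
            else chi (true :: spread false c1 (spread false c2 m0))).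
split=> /=; rewrite ?size_spread ?sz1 ?count_spread ?ct2 ?ct1 //.
move=> [|[] m] //= [sz]; rewrite spread_spread.
  move=> [ct]; have nk : n <= k by rewrite -ct -sz count_size.
  have szm0 : size m0 = k by rewrite size_cat !size_nseq subnKC.
  have ctm0 : count id m0 = n by rewrite count_cat !count_nseq /= mul1n mul0n addn0.
  by apply: hom; rewrite ?size_spread ?sz2 // count_spread ?ct2.
rewrite add0n => ct; rewrite hg //.
Qed.

Theorem ramsey_masks (n M : nat) (C : finType) :
  exists N, forall chi : seq bool -> C, exists c, homogeneous n M N chi c.
Proof.
elim: n M => [|n IH] M.
  exists M => chi; exists (nseq M true); split.
  - by rewrite size_nseq.
  - by rewrite count_nseq mul1n.
  - by move=> m m' sz sz' /count0_eq -> /count0_eq ->; rewrite sz sz'.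
have [N HN] := end_homogeneous (#|C| * M).+1 IH.
exists N => chi; have [c [g [szc ctc hg]]] := HN chi.
have [col hcol] := pigeonhole_color g (ltn0Sn _) (leqnSn (#|C| * M)).
(* Keep [M] elements whose subsets share the colour given by their least element. *)
set k := (#|C| * M).+1 in hg hcol ctc.
pose d0 := [seq g i == col | i <- iota 0 k].
have [d [szd ctd sub]] : exists d', [/\ size d' = size d0, count id d' = M &
    forall i, nth false d' i -> nth false d0 i].
  by apply: exists_submask; rewrite count_map.
rewrite size_map size_iota in szd.
exists (spread false c d); split; rewrite ?size_spread ?count_spread ?ctc //.
suff H m : size m = M -> count id m = n.+1 ->
    chi (spread false (spread false c d) m) = col.
  by move=> m m' *; rewrite !H.
move=> sz ct; rewrite spread_spread hg; last 2 first.
- by rewrite size_spread.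
- by rewrite count_spread ?ctd.
have hm : has id m by rewrite has_count ct.
have [/sub] := find_spread (etrans sz (esym ctd)) hm.
rewrite szd => + lt; rewrite (nth_map 0) ?size_iota // nth_iota // add0n.
by move/eqP.
Qed.

Local Open Scope ring_scope.

(** * Ramsey configurations on spheres *)

Definition sqdist (R : realType) (J : finType) (u v : J -> R) : R :=
  \sum_j (u j - v j) ^+ 2.

(** The points live in a finite set fixed before the colouring, so that colourings
    of it are again finite in number: this is what makes products work. *)
Definition sphere_ramsey (R : realType) (I : finType) (t : R) (D : I -> I -> R) :
    Prop :=
  forall C : finType, exists (J K : finType) (w : K -> J -> R),
    (forall k, \sum_j w k j ^+ 2 = t) /\
    forall chi : K -> C, exists f : I -> K, forall i j,
      chi (f i) = chi (f j) /\ sqdist (w (f i)) (w (f j)) = D i j.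

Lemma sphere_ramsey_ext (R : realType) (I : finType) (t t' : R)
    (D D' : I -> I -> R) :
  t = t' -> D =2 D' -> sphere_ramsey t D -> sphere_ramsey t' D'.
Proof.
move=> <- eD H C; have [J [K [w [nw Hw]]]] := H C.
exists J, K, w; split=> // chi; have [f Hf] := Hw chi.
by exists f => i j; rewrite -eD.
Qed.

Lemma sphere_ramsey_scale (R : realType) (I : finType) (c t : R)
    (D : I -> I -> R) :
  sphere_ramsey t D -> sphere_ramsey (c ^+ 2 * t) (fun i j => c ^+ 2 * D i j).
Proof.
move=> H C; have [J [K [w [nw Hw]]]] := H C.
exists J, K, (fun k j => c * w k j); split=> [k|chi].
  by rewrite -(nw k) mulr_sumr; apply: eq_bigr => j _; rewrite exprMn.
have [f Hf] := Hw chi; exists f => i j; have [-> <-] := Hf i j; split=> //.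
by rewrite /sqdist mulr_sumr; apply: eq_bigr => l _; rewrite -exprMn mulrBr.
Qed.

(** A colouring of the product colours each point of the second factor by the
    colouring that it induces on the first one. *)
Lemma sphere_ramsey_prod (R : realType) (I : finType) (t1 t2 : R)
    (D1 D2 : I -> I -> R) :
  sphere_ramsey t1 D1 -> sphere_ramsey t2 D2 ->
  sphere_ramsey (t1 + t2) (fun i j => D1 i j + D2 i j).
Proof.
move=> H1 H2 C; have [J1 [K1 [w1 [nw1 Hw1]]]] := H1 C.
have [J2 [K2 [w2 [nw2 Hw2]]]] := H2 {ffun K1 -> C}.
exists (J1 + J2)%type, (K1 * K2)%type,
  (fun k j => match j with inl j1 => w1 k.1 j1 | inr j2 => w2 k.2 j2 end).
split=> [[k1 k2]|chi]; first by rewrite big_sumType /= nw1 nw2.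
have [f2 Hf2] := Hw2 (fun k2 => [ffun k1 => chi (k1, k2)]).
case: (pickP I) => [i0 _|I0]; last first.
  by exists (fun i => False_rect _ (negP (negbT (I0 i)) isT)) => i; have := I0 i.
have [f1 Hf1] := Hw1 (fun k1 => chi (k1, f2 i0)).
have col i k1 : chi (k1, f2 i) = chi (k1, f2 i0).
  by have [/ffunP/(_ k1)] := Hf2 i i0; rewrite !ffunE.
exists (fun i => (f1 i, f2 i)) => i j; split; first by rewrite !col; case: (Hf1 i j).
by rewrite /sqdist big_sumType /= -(Hf1 i j).2 -(Hf2 i j).2.
Qed.

Lemma sphere_ramsey_pad (R : realType) (I : finType) (t t' : R)
    (D : I -> I -> R) : t <= t' ->
  sphere_ramsey t D -> sphere_ramsey t' D.
Proof.
move=> le H; suff Z : sphere_ramsey (t' - t) (fun _ _ : I => 0 : R).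
  apply: sphere_ramsey_ext (sphere_ramsey_prod H Z) => [|i j]; last exact: addr0.
  by rewrite addrC subrK.
move=> C; exists unit, unit, (fun _ _ => Num.sqrt (t' - t)); split.
  by move=> k; rewrite big_const card_unit /= addr0 sqr_sqrtr // subr_ge0.
move=> chi; exists (fun=> tt) => i j; split=> //.
by rewrite /sqdist big1 // => k _; rewrite subrr expr0n.
Qed.

(** A large regular simplex, coloured with few colours, contains a monochromatic
    simplex with vertex set [J] by the pigeonhole principle. *)
Lemma sphere_ramsey_partition (R : realType) (I J : finType) (g : I -> J) (l : R) :
  0 <= l ->
  sphere_ramsey (l / 2) (fun i j => l * (g i != g j)%:R).
Proof.
move=> l0 C; pose n := (#|C| * #|J|).+1; pose s := Num.sqrt (l / 2).
have s2 : s ^+ 2 = l / 2 by rewrite sqr_sqrtr // divr_ge0.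
have wE (a : 'I_n) : \sum_(b : 'I_n) (s * (a == b)%:R) ^+ 2 = l / 2.
  rewrite (bigD1 a) //= eqxx mulr1 s2 big1 ?addr0 // => b.
  by rewrite eq_sym => /negbTE ->; rewrite mulr0 expr0n.
exists 'I_n, 'I_n, (fun a b => s * (a == b)%:R); split=> // chi.
have [c hc] : exists c, (#|J| <= #|[pred a | chi a == c]|)%N.
  have [c hc] := @pigeonhole_color C #|J| n (fun i => chi (inord i)) isT (leqnSn _).
  exists c; apply: leq_trans hc _.
  have -> : #|[pred a | chi a == c]| = count [pred a | chi a == c] (enum 'I_n).
    by rewrite cardE {1}/enum_mem size_filter -enumT.
  rewrite -val_enum_ord count_map; apply: eq_leq.
  by apply: eq_count => i; rewrite inE /= inord_val.
pose h (j : J) : 'I_n := enum_val (widen_ord hc (enum_rank j)).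
have hinj : injective h.
  move=> x y /enum_val_inj /(congr1 val) /= e.
  by apply: enum_rank_inj; apply: val_inj.
exists (fun i => h (g i)) => i j; split.
  have H k : chi (h k) = c by apply/eqP; exact: (enum_valP (widen_ord hc (enum_rank k))).
  by rewrite !H.
rewrite /sqdist; have [->|ne] := eqVneq (g i) (g j).
  by rewrite mulr0 big1 // => k _; rewrite subrr expr0n.
rewrite (eq_bigr (fun b => (s * (h (g i) == b)%:R) ^+ 2 + (s * (h (g j) == b)%:R) ^+ 2)).
  by rewrite big_split /= !wE mulr1 -splitr.
move=> b _; rewrite sqrrB; suff -> : s * (h (g i) == b)%:R * (s * (h (g j) == b)%:R) = 0.
  by rewrite mul0rn subr0.
have [<-|] := eqVneq (h (g i)) b; last by rewrite mulr0 mul0r.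
by rewrite (inj_eq hinj) eq_sym (negbTE ne) !mulr0.
Qed.

Lemma sphere_ramsey_partitions (R : realType) (I J L : finType) (g : L -> I -> J)
    (l : L -> R) (t : R) (D : I -> I -> R) :
  (forall a, 0 <= l a) -> sphere_ramsey t D ->
  sphere_ramsey (t + (\sum_a l a) / 2)
    (fun i j => D i j + \sum_a l a * (g a i != g a j)%:R).
Proof.
move=> l0 H.
suff P (r : seq L) : sphere_ramsey (t + (\sum_(a <- r) l a) / 2)
    (fun i j => D i j + \sum_(a <- r) l a * (g a i != g a j)%:R) by exact: P.
elim: r => [|a r IH].
  apply: sphere_ramsey_ext H; first by rewrite big_nil mul0r addr0.
  by move=> i j; rewrite big_nil addr0.
apply: sphere_ramsey_ext (sphere_ramsey_prod IH (sphere_ramsey_partition (g a) (l0 a))).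
  by rewrite big_cons mulrDl (addrC (l a / 2)) addrA.
by move=> i j; rewrite big_cons (addrC (l a * _)) addrA.
Qed.

(** ** Configurations with the same nonzero entries *)

Definition nz (R : realType) (s : seq R) : seq R := [seq v <- s | v != 0].

Lemma spread_nz (R : realType) (y : seq R) :
  spread 0 [seq v != 0 | v <- y] (nz y) = y.
Proof. by elim: y => [|v y IH] //=; have [->|_] /= := eqVneq v 0; rewrite IH. Qed.

Lemma sum_spread_sqr (R : realType) (b : seq bool) (s : seq R) :
  count id b = size s ->
  \sum_(v <- spread 0 b s) v ^+ 2 = \sum_(v <- s) v ^+ 2.
Proof.
elim: b s => [|[] b IH] [|v s] //= ct; rewrite ?big_cons.
- by rewrite IH //; case: ct.
- by rewrite IH // expr0n add0r.
- by rewrite IH // big_cons expr0n add0r.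
Qed.

Definition seq_sqdist (R : realType) (s t : seq R) : R :=
  \sum_(p <- zip s t) (p.1 - p.2) ^+ 2.

Lemma seq_sqdist_nth (R : realType) n (s t : seq R) : size s = n -> size t = n ->
  \sum_(j < n) (s`_j - t`_j) ^+ 2 = seq_sqdist s t.
Proof.
move=> <- {n} st; rewrite /seq_sqdist (big_nth (0, 0)) size_zip st minnn big_mkord.
by apply: eq_bigr => i _; rewrite nth_zip.
Qed.

Lemma seq_sqdist_spread (R : realType) (c : seq bool) (s t : seq R) :
  size s = count id c -> size t = count id c ->
  seq_sqdist (spread 0 c s) (spread 0 c t) = seq_sqdist s t.
Proof.
rewrite /seq_sqdist; elim: c s t => [|[] c IH] [|u s] [|v t] //= ss tt; rewrite ?add0n in ss tt.
- by case: ss tt => ss [tt]; rewrite !big_cons IH.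
- by rewrite big_cons IH //= subrr expr0n add0r.
- by rewrite -ss in tt.
- by rewrite -tt in ss.
- by rewrite big_cons IH //= subrr expr0n add0r.
Qed.

(** Colour the increasing embeddings of the sequence [a] of nonzero entries into
    a long interval of coordinates: this is a colouring of the [size a]-subsets
    of that interval.  On a set of coordinates that is homogeneous for it all
    the rows [y i] get the same colour. *)
Lemma sphere_ramsey_rows (R : realType) (I : finType) (M : nat) (y : I -> seq R)
    (a : seq R) :
  (forall i, size (y i) = M) -> (forall i, nz (y i) = a) ->
  sphere_ramsey (\sum_(v <- a) v ^+ 2) (fun i j => seq_sqdist (y i) (y j)).
Proof.
move=> szy nzy C; pose n := size a.
have [N HN] := ramsey_masks n M (option C).
pose K : finType := {b : N.-tuple bool | count id b == n}.
exists 'I_N, K, (fun (k : K) (j : 'I_N) => (spread 0 (val k) a)`_j); split=> [[b /= /eqP cb]|chi].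
  rewrite -(sum_spread_sqr (s := a) cb) (big_nth 0) big_mkord size_spread size_tuple.
  by [].
pose toK (b : seq bool) : option K := obind insub (insub b).
have toKE (b : seq bool) (sz : size b = N) (ct : count id b = n) :
    exists2 k : K, toK b = Some k & b = val (val k) :> seq bool.
  have sz' : size b == N by apply/eqP.
  have ct' : count id (Tuple sz') == n by apply/eqP.
  exists (exist _ (Tuple sz') ct') => //.
  by rewrite /toK insubT /= insubT /=.
have [c [szc ctc hom]] := HN (fun b => omap chi (toK b)).
pose m i := [seq v != 0 | v <- y i].
have szm i : size (m i) = M by rewrite size_map.
have ctm i : count id (m i) = n.
  by rewrite /n -(nzy i) size_filter count_map.
have key i : exists k : K, toK (spread false c (m i)) = Some k /\
    spread 0 (val k) a = spread 0 c (y i).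
  have [||k e1 e2] := toKE (spread false c (m i)).
  - by rewrite size_spread.
  - by rewrite count_spread ?ctm // szm.
  by exists k; rewrite -e2 spread_spread -(nzy i) spread_nz.
have [f Hf] := choice key; exists f => i j.
have [ei vi] := Hf i; have [ej vj] := Hf j; split.
  have := hom _ _ (szm i) (szm j) (ctm i) (ctm j).
  by rewrite ei ej => -[].
rewrite /sqdist -(seq_sqdist_spread (c := c)) ?szy ?ctc // -vi -vj.
by apply: seq_sqdist_nth; rewrite size_spread size_tuple.
Qed.

(** * Almost dilation-invariant weights on the positive integers *)

Section Dilation.
Variable R : realType.
Implicit Types (a : nat -> R) (u v B Z : nat).

Definition dilate u a n : R := if (u %| n)%N then a (n %/ u)%N else 0.

Lemma dilate_dilate u v a n : (0 < u)%N -> dilate u (dilate v a) n = dilate (u * v) a n.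
Proof.
move=> u0; rewrite /dilate divnMA; case: (boolP (u %| n)%N) => [dun|ndun].
  by rewrite dvdn_divRL // mulnC.
by case: ifP => // /(dvdn_trans (dvdn_mulr v (dvdnn u))) dun; rewrite dun in ndun.
Qed.

Lemma dilate_ge0 u a n : (forall m, 0 <= a m) -> 0 <= dilate u a n.
Proof. by move=> a0; rewrite /dilate; case: ifP. Qed.

Lemma sum_dilate_mul u a B : (0 < u)%N ->
  \sum_(0 <= n < u * B) dilate u a n = \sum_(0 <= m < B) a m.
Proof.
move=> u0; elim: B => [|B IH]; first by rewrite muln0 !big_geq.
rewrite (big_cat_nat (n := (u * B)%N)) //= ?leq_mul // IH [RHS]big_nat_recr //=.
congr (_ + _); rewrite big_ltn; last by rewrite ltn_mul2l u0 /=.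
rewrite {1}/dilate dvdn_mulr // mulKn // big_nat big1 ?addr0 // => n /andP[lo hi].
rewrite /dilate; case: ifP => // /dvdnP[k ek]; exfalso.
by move: lo hi; rewrite ek (mulnC k u) !ltn_mul2l u0 /=; lia.
Qed.

Lemma sum_nat_support a B Z : (B <= Z)%N -> (forall n, (B <= n)%N -> a n = 0) ->
  \sum_(0 <= n < Z) a n = \sum_(0 <= n < B) a n.
Proof.
move=> le a0; rewrite (big_cat_nat (n := B)) //= [X in _ + X](_ : _ = 0) ?addr0 //.
by rewrite big_nat big1 // => n /andP[/a0].
Qed.

Lemma dilate_support u a B n : (forall n, (B <= n)%N -> a n = 0) -> (0 < u)%N ->
  (u * B <= n)%N -> dilate u a n = 0.
Proof.
move=> a0 u0 le; rewrite /dilate; case: ifP => // _; apply: a0.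
by rewrite leq_divRL // mulnC.
Qed.

Lemma sum_dilate u a B Z : (forall n, (B <= n)%N -> a n = 0) -> (0 < u)%N ->
  (u * B <= Z)%N -> \sum_(0 <= n < Z) dilate u a n = \sum_(0 <= m < B) a m.
Proof.
move=> a0 u0 le; rewrite -[RHS](sum_dilate_mul _ _ u0); apply: sum_nat_support => //.
by move=> n; exact: dilate_support.
Qed.

Lemma sum_dilate_le u a Z : (forall n, 0 <= a n) -> (0 < u)%N ->
  \sum_(0 <= n < Z) dilate u a n <= \sum_(0 <= m < Z) a m.
Proof.
move=> a0 u0; rewrite -[leRHS](sum_dilate_mul _ _ u0).
rewrite [leRHS](big_cat_nat (n := Z)) //= ?leq_pmull //.
by rewrite lerDl sumr_ge0 // => n _; exact: dilate_ge0.
Qed.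

Definition weight B a : Prop :=
  [/\ a 0%N = 0, forall n, 0 <= a n, forall n, (B <= n)%N -> a n = 0 &
      \sum_(0 <= n < B) a n = 1].

(** The multiplicative semigroup generated by [1, ..., Q] is amenable: averaging
    over the dilations by the first [L] powers of a further generator makes a
    weight almost invariant under that generator and, dilations commuting with
    each other, does not spoil the invariance obtained before. *)
Lemma almost_invariant_weight (Q : nat) (eps : R) : 0 < eps ->
  exists B a, weight B a /\ forall u, (0 < u <= Q)%N -> forall Z,
    \sum_(0 <= n < Z) `|dilate u a n - a n| <= eps.
Proof.
move=> e0; elim: Q => [|Q [B [a [[a00 age0 asup asum] inv]]]].
  exists 2%N, (fun n => (n == 1%N)%:R); split; last by move=> [|u].
  split=> //; first by move=> [|[|n]].
  by rewrite unlock /= add0r addr0.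
pose g := Q.+1; have g0 t : (0 < g ^ t)%N by rewrite expn_gt0.
have [L Le] : exists L : nat, 2 / eps <= L.+1%:R.
  exists (Num.truncn (2 / eps)); apply: ltW.
  by rewrite truncnS_gt // divr_ge0 // ltW.
pose s n : R := \sum_(0 <= t < L.+1) dilate (g ^ t) a n.
pose l : R := L.+1%:R; have l0 : 0 < l by rewrite ltr0n.
have supp t n : (t <= L)%N -> (g ^ L * B <= n)%N -> dilate (g ^ t) a n = 0.
  move=> tL le; apply: (dilate_support asup (g0 t)); apply: leq_trans le.
  by rewrite leq_mul2r leq_pexp2l ?orbT.
exists (g ^ L * B)%N, (fun n => l^-1 * s n); split.
  split.
  - rewrite /s big1 ?mulr0 // => t _; rewrite /dilate dvdn0 div0n; exact: a00.
  - move=> n; rewrite mulr_ge0 ?invr_ge0 ?(ltW l0) //.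
    by apply: sumr_ge0 => t _; exact: dilate_ge0.
  - move=> n le; rewrite /s big_nat big1 ?mulr0 // => t /andP[_ tL]; exact: supp.
  - rewrite -mulr_sumr /s exchange_big /= big_nat (eq_bigr (fun=> 1)).
      by rewrite -big_nat big_const_nat subn0 iter_addr_0 mulVf // gt_eqF.
    move=> t /andP[_ tL]; rewrite (sum_dilate asup) //.
    by rewrite leq_mul2r leq_pexp2l ?orbT.
move=> u /andP[u0 uQ] Z.
have dils n : dilate u (fun n => l^-1 * s n) n
    = l^-1 * \sum_(0 <= t < L.+1) dilate (u * g ^ t) a n.
  under eq_bigr do rewrite -dilate_dilate //.
  by rewrite /dilate /s; case: ifP => // _; rewrite big1 // mulr0.
rewrite (eq_bigr (fun n => l^-1 * `|\sum_(0 <= t < L.+1) dilate (u * g ^ t) a n - s n|)); last first.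
  by move=> n _; rewrite dils -mulrBr normrM ger0_norm // invr_ge0 ltW.
rewrite -mulr_sumr mulrC ler_pdivrMr //.
move: uQ; rewrite leq_eqVlt => /orP[/eqP ug|]; last first.
  rewrite ltnS => uQ.
  have step n : `|\sum_(0 <= t < L.+1) dilate (u * g ^ t) a n - s n| <=
      \sum_(0 <= t < L.+1) dilate (g ^ t) (fun m => `|dilate u a m - a m|) n.
    rewrite /s -sumrB; apply: le_trans (ler_norm_sum _ _ _) _; apply: ler_sum => t _.
    rewrite mulnC -dilate_dilate // /dilate; case: ifP => // _; by rewrite subrr normr0.
  apply: le_trans (ler_sum _ (fun n _ => step n)) _.
  rewrite exchange_big /=; apply: (@le_trans _ _ (\sum_(0 <= t < L.+1) eps)).
    apply: ler_sum => t _; apply: le_trans (sum_dilate_le _ _ _) _ => //.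
    by apply: inv; rewrite u0.
  by rewrite big_const_nat subn0 iter_addr_0 mulr_natr.
have tele n : \sum_(0 <= t < L.+1) dilate (u * g ^ t) a n - s n =
    dilate (g ^ L.+1) a n - dilate (g ^ 0) a n.
  rewrite ug /s -sumrB.
  under eq_bigr do rewrite -expnS.
  by rewrite (telescope_sumr (fun t => dilate (g ^ t) a n)).
apply: (@le_trans _ _ (\sum_(0 <= n < Z) (dilate (g ^ L.+1) a n + dilate (g ^ 0) a n))).
  apply: ler_sum => n _; rewrite tele; apply: le_trans (ler_normB _ _) _.
  by rewrite !ger0_norm // dilate_ge0.
have mass t : \sum_(0 <= n < Z) dilate (g ^ t) a n <= 1.
  rewrite -asum; apply: le_trans (sum_dilate_le _ age0 (g0 t)) _.
  rewrite -(sum_nat_support (leq_addr Z B) asup).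
  rewrite [leRHS](big_cat_nat (n := Z)) //= ?leq_addl // lerDl.
  by rewrite sumr_ge0.
rewrite big_split /=; apply: le_trans (lerD (mass _) (mass _)) _.
by rewrite -[1 + 1]/2%:R -ler_pdivrMl // mulrC.
Qed.

End Dilation.

(** * A self-similar sequence *)

Section Sequences.
Variable R : realType.
Implicit Types (s t : seq R).

Definition sdot s t : R := \sum_(p <- zip s t) p.1 * p.2.

Lemma sdotC s t : size s = size t -> sdot s t = sdot t s.
Proof.
elim: s t => [|x s IH] [|y t] //= [/IH e].
by move: e; rewrite /sdot /= !big_cons mulrC => ->.
Qed.

Lemma seq_sqdist_sdot s t : size s = size t ->
  seq_sqdist s t = sdot s s + sdot t t - 2 * sdot s t.
Proof.
elim: s t => [|x s IH] [|y t] //= => [_|[/IH]].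
  by rewrite /seq_sqdist /sdot !big_nil mulr0 subr0 addr0.
rewrite /seq_sqdist /sdot /= !big_cons => -> /=; ring.
Qed.

Lemma sdot_cons x y s t : sdot (x :: s) (y :: t) = x * y + sdot s t.
Proof. by rewrite /sdot /= big_cons. Qed.

Lemma sdot_cat s1 s2 t1 t2 : size s1 = size t1 ->
  sdot (s1 ++ s2) (t1 ++ t2) = sdot s1 t1 + sdot s2 t2.
Proof. by move=> e; rewrite /sdot zip_cat // big_cat. Qed.

Lemma sdot_map (T : Type) (f g : T -> R) (r : seq T) :
  sdot [seq f x | x <- r] [seq g x | x <- r] = \sum_(x <- r) f x * g x.
Proof. by elim: r => [|x r IH]; rewrite ?big_cons -?IH /sdot /= ?big_nil ?big_cons. Qed.

Lemma sdot_flatten_map (T : Type) (f g : T -> seq R) (r : seq T) :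
  (forall x, size (f x) = size (g x)) ->
  sdot (flatten [seq f x | x <- r]) (flatten [seq g x | x <- r]) =
  \sum_(x <- r) sdot (f x) (g x).
Proof.
move=> szE; elim: r => [|x r IH]; first by rewrite /sdot !big_nil.
by rewrite /= sdot_cat // IH big_cons.
Qed.

Lemma nz_flatten (ss : seq (seq R)) : nz (flatten ss) = flatten [seq nz s | s <- ss].
Proof. exact: filter_flatten. Qed.

Lemma nz_flatten_map (T : Type) (f g : T -> seq R) (r : seq T) :
  (forall x, nz (f x) = nz (g x)) ->
  nz (flatten [seq f x | x <- r]) = nz (flatten [seq g x | x <- r]).
Proof.
by move=> e; rewrite !nz_flatten -!map_comp; congr flatten; apply: eq_map => x /=.
Qed.

Lemma nz_flatten0 (f : nat -> seq R) (r : seq nat) :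
  {in r, forall x, nz (f x) = [::]} -> nz (flatten [seq f x | x <- r]) = [::].
Proof.
elim: r => //= x r IH f0; rewrite /nz filter_cat [X in X ++ _]f0 ?mem_head //.
by apply: IH => y yr; apply: f0; rewrite in_cons yr orbT.
Qed.

Lemma nz_map0 (f : nat -> R) (r : seq nat) :
  {in r, forall x, f x = 0} -> nz [seq f x | x <- r] = [::].
Proof.
move=> f0; rewrite -flatten_map1; apply: nz_flatten0 => x /f0 /= ->.
by rewrite /nz /= eqxx.
Qed.

Lemma nz_flatten_sparse (k n : nat) (f : nat -> seq R) : (0 < k)%N ->
  (forall x, ~~ (k %| x)%N -> nz (f x) = [::]) ->
  nz (flatten [seq f x | x <- iota 0 (k * n)]) =
  nz (flatten [seq f (k * x)%N | x <- iota 0 n]).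
Proof.
move=> k0 f0; elim: n => [|n IH]; first by rewrite muln0.
rewrite mulnS addnC iotaD map_cat flatten_cat.
rewrite -(addn1 n) (iotaD 0 n 1) map_cat flatten_cat !add0n /= cats0 /nz !filter_cat.
congr (_ ++ _); first exact: IH.
rewrite -(prednK k0) /= filter_cat (prednK k0) -[RHS]cats0; congr (_ ++ _).
apply: nz_flatten0 => x; rewrite mem_iota => /andP[lo hi]; apply: f0.
apply/negP => /dvdnP[q ex]; move: lo hi; rewrite ex addSnnS prednK //.
by rewrite -mulnSr (mulnC q) ltn_pmul2l // ltn_pmul2l // ltnS ltnNge => /negbTE ->.
Qed.

Lemma nz_map_sparse (k n : nat) (f : nat -> R) : (0 < k)%N ->
  (forall x, ~~ (k %| x)%N -> f x = 0) ->
  nz [seq f x | x <- iota 0 (k * n)] = nz [seq f (k * x)%N | x <- iota 0 n].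
Proof.
move=> k0 f0; have := nz_flatten_sparse (f := fun x => [:: f x]) n k0.
by rewrite !flatten_map1; apply=> x /f0 fx; rewrite /nz /= fx eqxx.
Qed.

Lemma nz_map_trim (m n : nat) (f : nat -> R) : (m <= n)%N ->
  (forall x, (m <= x)%N -> f x = 0) ->
  nz [seq f x | x <- iota 0 n] = nz [seq f x | x <- iota 0 m].
Proof.
move=> mn f0; rewrite -(subnKC mn) iotaD map_cat /nz filter_cat add0n.
have := @nz_map0 f (iota m (n - m)); rewrite /nz => ->; first by rewrite cats0.
by move=> x; rewrite mem_iota => /andP[/f0 fx _].
Qed.

End Sequences.

Section SelfSimilar.
Variables (R : realType) (B Q : nat) (a : nat -> R).
Hypothesis wa : weight B a.

Let a00 : a 0%N = 0. Proof. by case: wa. Qed.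
Let age0 n : 0 <= a n. Proof. by case: wa. Qed.
Let asup n : (B <= n)%N -> a n = 0. Proof. by case: wa => _ _ + _; apply. Qed.

Let N := B`!.
Let K := Q`!.

(** Level [m] consists of [m] equally spaced points that share the weight [a m]
    of the level equally. *)
Definition amplitude (m : nat) : R := Num.sqrt (a m / m%:R).

(** The coordinates of a block are the pairs of an abscissa [x] and a level [n], in
    lexicographic order; the points of level [n] are the multiples of
    [N * K / n]. *)
Definition entry (u x n : nat) : R :=
  if (N * K %| x * n)%N then dilate u amplitude n else 0.

Definition block (u : nat) : seq R :=
  flatten [seq [seq entry u x n | n <- iota 0 (K * B)] | x <- iota 0 (K * N)].

Definition core_row (x : nat) : seq R :=
  [seq if (N %| x * m)%N then amplitude m else 0 | m <- iota 0 B].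

Definition core (u : nat) : seq R :=
  flatten [seq core_row x | x <- iota 0 (u * N)].

Lemma amplitude_support m : (0 < m < B)%N \/ amplitude m = 0.
Proof.
have [->|m0] := posnP m; first by right; rewrite /amplitude a00 mul0r sqrtr0.
have [mB|/asup am] := ltnP m B; first by left.
by right; rewrite /amplitude am mul0r sqrtr0.
Qed.

Lemma dilate_amplitude_support u n : (u <= Q)%N ->
  dilate u amplitude n = 0 \/ [/\ (0 < u)%N, (0 < n < K * B)%N & (n %| N * K)%N].
Proof.
move=> uQ; rewrite /dilate; case: ifP => [/dvdnP[m ->]|_]; last by left.
have [->|u0] := posnP u; first by rewrite divn0; case: (amplitude_support 0); [|left].
rewrite mulnK //; case: (amplitude_support m); [move=> /andP[m0 mB]|by left].
have uK : (u %| K)%N by rewrite dvdn_fact // u0.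
right; split; rewrite // ?muln_gt0 ?m0 ?u0 /=.
  rewrite mulnC; apply: leq_ltn_trans (_ : K * m < _)%N.
    by rewrite leq_mul2r (dvdn_leq _ uK) ?orbT // fact_gt0.
  by rewrite ltn_mul2l fact_gt0.
by apply: dvdn_mul => //; rewrite dvdn_fact // m0 ltnW.
Qed.

Lemma core_add u v : core (u + v) = core u ++ core v.
Proof.
rewrite /core mulnDl iotaD map_cat flatten_cat add0n; congr (_ ++ flatten _).
rewrite -[X in iota X]addn0 iotaDl -map_comp; apply: eq_map => x /=.
apply: eq_map => m; rewrite mulnDl dvdn_addr //.
by rewrite -mulnA mulnCA dvdn_mulr.
Qed.

(** The nonzero entries of [block u] at abscissa [x] on level [n] are those of
    [core u] at abscissa [x * u / K] on level [n / u]: the blocks are [u]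
    consecutive copies of one sequence, dilated into the same coordinates. *)
Lemma nz_block u : (u <= Q)%N -> nz (block u) = nz (core u).
Proof.
move=> uQ; have [u0|u0] := posnP u.
  rewrite u0 /core mul0n /block; apply: nz_flatten0 => x _.
  apply: nz_map0 => n _; rewrite /entry; case: ifP => // _.
  by case: (dilate_amplitude_support n (leq0n Q)) => [->|[]].
have uK : (u %| K)%N by rewrite dvdn_fact // u0.
pose k := (K %/ u)%N; have Ek : K = (u * k)%N by rewrite mulnC divnK.
have k0 : (0 < k)%N by rewrite divn_gt0 // dvdn_leq // fact_gt0.
have entry0 x n : entry u x n != 0 -> (k %| x)%N /\ (u %| n)%N.
  rewrite /entry; case: ifP => [|_]; last by rewrite eqxx.
  rewrite /dilate; case: ifP => [/dvdnP[m ->]|_]; last by rewrite eqxx.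
  rewrite mulnK // => dx; case: (amplitude_support m) => [/andP[m0 mB] _|->]; last by rewrite eqxx.
  split=> //.
  have /dvdnP[c ec] : (m %| N)%N by rewrite dvdn_fact // m0 ltnW.
  move: dx; rewrite ec Ek.
  have -> : (c * m * (u * k) = c * k * (m * u))%N by lia.
  by rewrite dvdn_pmul2r ?muln_gt0 ?m0 // => h; apply: dvdn_trans h; by rewrite dvdn_mull.
rewrite /block /core {2}Ek (mulnC u k) -mulnA nz_flatten_sparse //; last first.
  move=> x kx; apply: nz_map0 => n _; have [//|/entry0[dx _]] := eqVneq (entry u x n) 0.
  by rewrite dx in kx.
apply: nz_flatten_map => x; rewrite {1}Ek -mulnA nz_map_sparse //; last first.
  by move=> n un; apply/eqP; apply: contraNT un => /entry0[].
rewrite (nz_map_trim (m := B)) ?leq_pmull //; last first.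
  move=> m mB; rewrite /entry /dilate (dvdn_mulr m (dvdnn u)) mulKn //.
  by case: ifP => // _; rewrite /amplitude asup // mul0r sqrtr0.
congr nz; apply: eq_map => m; rewrite /entry /dilate (dvdn_mulr m (dvdnn u)) mulKn //.
congr (if _ then _ else _).
have -> : (k * x * (u * m) = x * m * (u * k))%N by lia.
by rewrite -Ek dvdn_pmul2r // fact_gt0.
Qed.

Lemma size_block u : size (block u) = (K * B * (K * N))%N.
Proof. by rewrite size_allpairs !size_iota mulnC. Qed.

Definition overlap (u v : nat) : R :=
  \sum_(0 <= n < K * B) Num.sqrt (dilate u a n * dilate v a n).

Lemma count_multiples n : (0 < n)%N -> (n %| N * K)%N ->
  \sum_(0 <= x < K * N) ((N * K %| x * n)%N)%:R = n%:R :> R.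
Proof.
move=> n0 /dvdnP[c ec]; rewrite (mulnC K) ec.
have c0 : (0 < c)%N.
  rewrite lt0n; apply/eqP => c0; move/eqP: ec.
  by rewrite c0 mul0n muln_eq0 !eqn0Ngt !fact_gt0.
rewrite (eq_bigr (dilate c (fun=> 1))).
  rewrite sum_dilate_mul // big_const_nat subn0 iter_addr_0 //.
by move=> x _; rewrite dvdn_pmul2r // /dilate; case: ifP.
Qed.

Lemma dilate_amplitude u v n : (0 < n)%N ->
  n%:R * (dilate u amplitude n * dilate v amplitude n) =
  Num.sqrt (u%:R * v%:R) * Num.sqrt (dilate u a n * dilate v a n).
Proof.
move=> n0; rewrite /dilate; case: ifP => [du|_]; last by rewrite !mul0r sqrtr0 !mulr0.
case: ifP => [dv|_]; last by rewrite !mulr0 sqrtr0 !mulr0.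
have amp w : (w %| n)%N -> amplitude (n %/ w) = Num.sqrt (w%:R * a (n %/ w)%N / n%:R).
  case/dvdnP=> m en; rewrite en; rewrite en muln_gt0 in n0; case/andP: n0 => m0 w0.
  rewrite mulnK // /amplitude natrM; congr Num.sqrt.
  have mR : (m%:R : R) != 0 by rewrite pnatr_eq0 -lt0n.
  have wR : (w%:R : R) != 0 by rewrite pnatr_eq0 -lt0n.
  by field; rewrite mR wR.
have ge0 w : 0 <= w%:R * a (n %/ w)%N :> R by rewrite mulr_ge0.
have nR : (n%:R : R) != 0 by rewrite pnatr_eq0 -lt0n.
have {1}-> : n%:R = Num.sqrt (n%:R ^+ 2) :> R by rewrite sqrtr_sqr ger0_norm.
rewrite !amp // -!sqrtrM ?sqr_ge0 ?divr_ge0 ?mulr_ge0 //.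
by congr Num.sqrt; field.
Qed.

(** Level [n] of [block u] has the same [n] points as level [n] of [block v], so the
    inner product only compares the weights that the two dilations give to it. *)
Lemma sdot_block u v : (u <= Q)%N -> (v <= Q)%N ->
  sdot (block u) (block v) = Num.sqrt (u%:R * v%:R) * overlap u v.
Proof.
move=> uQ vQ; rewrite sdot_flatten_map; last by move=> x; rewrite !size_map.
under eq_bigr do rewrite sdot_map.
rewrite exchange_big /= /overlap mulr_sumr /index_iota subn0.
apply: eq_bigr => n _.
rewrite (eq_bigr (fun x => ((N * K %| x * n)%N)%:R *
    (dilate u amplitude n * dilate v amplitude n))); last first.
  by move=> x _; rewrite /entry; case: ifP => _; rewrite ?mul1r ?mul0r.
rewrite -mulr_suml.
have [n0|n0] := posnP n.
  rewrite n0 /dilate !dvdn0 !div0n a00 mul0r sqrtr0 mulr0.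
  by rewrite /amplitude a00 mul0r sqrtr0 !mulr0.
rewrite -dilate_amplitude //.
case: (dilate_amplitude_support n uQ) => [->|[_ _ dn]]; first by rewrite !mul0r !mulr0.
by have := count_multiples n0 dn; rewrite /index_iota subn0 => ->.
Qed.

Lemma sum_dilate_weight u : (0 < u <= Q)%N -> \sum_(0 <= n < K * B) dilate u a n = 1.
Proof.
move=> /andP[u0 uQ]; rewrite (sum_dilate (B := B)) //; first by case: wa.
by rewrite leq_mul2r dvdn_leq ?fact_gt0 ?orbT // dvdn_fact // u0.
Qed.

Lemma overlap_id u : (0 < u <= Q)%N -> overlap u u = 1.
Proof.
move=> uQ; rewrite -(sum_dilate_weight uQ); apply: eq_bigr => n _.
by rewrite -expr2 sqrtr_sqr ger0_norm // dilate_ge0.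
Qed.

Lemma sqrt_mul_bounds (x y : R) : 0 <= x -> 0 <= y ->
  (x + y - `|x - y|) / 2 <= Num.sqrt (x * y) <= (x + y) / 2.
Proof.
move=> x0 y0; apply/andP; split.
  wlog xy : x y x0 y0 / x <= y.
    move=> H; have [/H|/ltW/H] := leP x y; first by apply.
    by rewrite distrC (addrC y) (mulrC y); apply.
  rewrite ler0_norm ?subr_le0 //.
  have -> : (x + y - - (x - y)) / 2 = Num.sqrt (x * x).
    by rewrite -expr2 sqrtr_sqr ger0_norm //; field.
  by rewrite ler_sqrt ?mulr_ge0 // ler_wpM2l.
have s0 : 0 <= (x + y) / 2 by rewrite divr_ge0 ?addr_ge0.
rewrite -[leRHS]ger0_norm // -sqrtr_sqr ler_sqrt ?sqr_ge0 //.
rewrite -subr_ge0; have -> : ((x + y) / 2) ^+ 2 - x * y = ((x - y) / 2) ^+ 2 by field.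
exact: sqr_ge0.
Qed.

Lemma overlap_bounds eps u v : (0 < u <= Q)%N -> (0 < v <= Q)%N ->
  (forall w, (0 < w <= Q)%N -> forall Z,
    \sum_(0 <= n < Z) `|dilate w a n - a n| <= eps) ->
  1 - eps <= overlap u v <= 1.
Proof.
move=> uQ vQ inv; pose S (f : nat -> R) := \sum_(0 <= n < K * B) f n.
have b n := sqrt_mul_bounds (dilate_ge0 u n age0) (dilate_ge0 v n age0).
have mean : S (fun n => (dilate u a n + dilate v a n) / 2) = 1.
  by rewrite /S -mulr_suml big_split /= !sum_dilate_weight //; field.
apply/andP; split; last first.
  by rewrite -mean; apply: ler_sum => n _; case/andP: (b n).
apply: (@le_trans _ _ (S (fun n => (dilate u a n + dilate v a n - `|dilate u a n - dilate v a n|) / 2))).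
  have -> : S (fun n => (dilate u a n + dilate v a n - `|dilate u a n - dilate v a n|) / 2) =
      1 - S (fun n => `|dilate u a n - dilate v a n|) / 2.
    by rewrite -[X in _ = X - _]mean /S mulr_suml -sumrB; apply: eq_bigr => n _; rewrite mulrBl.
  rewrite lerD2l lerN2 ler_pdivrMr //.
  apply: (@le_trans _ _ (S (fun n => `|dilate u a n - a n| + `|dilate v a n - a n|))).
    apply: ler_sum => n _; rewrite (distrC (dilate v a n)).
    exact: ler_distD.
  rewrite /S big_split mulr_natr mulr2n; apply: lerD; exact: inv.
by apply: ler_sum => n _; case/andP: (b n).
Qed.

End SelfSimilar.

(** ** Signs *)

Section Signs.
Variables (R : realType) (T : nat).

Let c : R := (Num.sqrt T.+1%:R)^-1.

Definition wave (v : R) : seq R := [seq c * v * (-1) ^+ i | i <- iota 0 T.+1].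

(** Shifting an alternating sequence by one coordinate almost negates it. *)
Definition signed (b : bool) (v : R) : seq R :=
  if b then 0 :: wave v else rcons (wave v) 0.

Lemma size_signed b v : size (signed b v) = T.+2.
Proof. by case: b; rewrite /= ?size_rcons size_map size_iota. Qed.

Lemma nz_signed b v : nz (signed b v) = nz (wave v).
Proof. by case: b; rewrite /nz /signed ?filter_rcons /= eqxx. Qed.

Lemma nz_wave0 : nz (wave 0) = [::].
Proof. by apply: nz_map0 => i _; rewrite mulr0 mul0r. Qed.

Definition sign_factor (b b' : bool) : R :=
  if b == b' then 1 else - (T%:R / T.+1%:R).

Let c2 : c * c = T.+1%:R^-1.
Proof. by rewrite -invfM -expr2 sqr_sqrtr. Qed.

Lemma sdot_wave v v' : sdot (wave v) (wave v') = v * v'.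
Proof.
rewrite sdot_map (eq_bigr (fun=> T.+1%:R^-1 * (v * v'))).
  rewrite big_const_seq count_predT size_iota iter_addr_0 -mulrnAl.
  by rewrite -[X in X * _]mulr_natr mulVf ?mul1r // pnatr_eq0.
move=> i _; rewrite -c2; have s2 : (-1) ^+ i * (-1) ^+ i = 1 :> R.
  by rewrite -exprMn mulrNN mulr1 expr1n.
have -> : c * v * (-1) ^+ i * (c * v' * (-1) ^+ i) =
  c * c * (v * v') * ((-1) ^+ i * (-1) ^+ i) by ring.
by rewrite s2 mulr1.
Qed.

Lemma sdot_signed b b' v v' :
  sdot (signed b v) (signed b' v') = sign_factor b b' * (v * v').
Proof.
suff diff w w' : sdot (signed false w) (signed true w') =
    - (T%:R / T.+1%:R) * (w * w').
  case: b b' => -[]; rewrite /sign_factor [_ == _]/=.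
  - by rewrite sdot_cons mulr0 add0r sdot_wave mul1r.
  - by rewrite sdotC ?size_signed // diff (mulrC v).
  - exact: diff.
  - rewrite /signed -!cats1 sdot_cat ?size_map // sdot_wave.
    by rewrite /sdot big_seq1 mulr0 addr0 mul1r.
change (sdot (rcons (wave w) 0) (0 :: wave w') = - (T%:R / T.+1%:R) * (w * w')).
have -> : wave w' = rcons [seq c * w' * (-1) ^+ i | i <- iota 0 T] (c * w' * (-1) ^+ T).
  by rewrite /wave -(addn1 T) iotaD map_cat cats1.
have -> : wave w = c * w * (-1) ^+ 0 :: [seq c * w * (-1) ^+ i.+1 | i <- iota 0 T].
  by rewrite /wave /= (iotaDl 1 0) -map_comp.
rewrite rcons_cons sdot_cons mulr0 add0r.
rewrite -!cats1 sdot_cat ?size_map // sdot_map (eq_bigr (fun=> - (T.+1%:R^-1 * (w * w')))).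
  rewrite /sdot big_seq1 mul0r addr0 big_const_seq count_predT size_iota iter_addr_0.
  by rewrite -[LHS]mulr_natr; ring.
move=> i _; rewrite -c2 exprS.
have s2 : (-1) ^+ i * (-1) ^+ i = 1 :> R by rewrite -exprMn mulrNN mulr1 expr1n.
transitivity (- (c * c * (w * w')) * ((-1) ^+ i * (-1) ^+ i)); first by ring.
by rewrite s2 mulr1.
Qed.

Lemma sdot_flatten_signed b b' s t : size s = size t ->
  sdot (flatten [seq signed b v | v <- s]) (flatten [seq signed b' v | v <- t]) =
  sign_factor b b' * sdot s t.
Proof.
elim: s t => [|x s IH] [|y t] //=; first by rewrite /sdot !big_nil mulr0.
case=> /IH e; rewrite sdot_cat ?size_signed // e sdot_signed /sdot /= big_cons.
by rewrite mulrDr.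
Qed.

Lemma nz_flatten_signed b s :
  nz (flatten [seq signed b v | v <- s]) = flatten [seq nz (wave v) | v <- nz s].
Proof.
elim: s => // v s IH; have -> : nz (v :: s) = if v != 0 then v :: nz s else nz s by [].
have -> : nz (flatten [seq signed b v | v <- v :: s]) =
    nz (signed b v) ++ nz (flatten [seq signed b v | v <- s]) by exact: filter_cat.
by rewrite IH nz_signed; have [->|//] := eqVneq v 0; rewrite nz_wave0.
Qed.

End Signs.

(** There is a sequence such that [u] consecutive copies of it agree, up to
    inserted zeros and a small error, with the sequence multiplied by
    [sqrt u] or by [- sqrt u]. *)
Lemma self_similar_blocks (R : realType) (Q : nat) (eps : R) : 0 < eps ->
  exists (M : nat) (W : bool -> nat -> seq R) (G : nat -> seq R),
  [/\ forall b u, size (W b u) = M,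
      {morph G : u v / (u + v)%N >-> u ++ v},
      forall b u, (u <= Q)%N -> nz (W b u) = G u,
      forall b u, (u <= Q)%N -> sdot (W b u) (W b u) = u%:R &
      forall b b' u v, (u <= Q)%N -> (v <= Q)%N ->
        `|sdot (W b u) (W b' v) - (-1) ^+ (b != b') * Num.sqrt (u%:R * v%:R)| <=
        eps * Num.sqrt (u%:R * v%:R)].
Proof.
move=> e0; have [B [a [wa inv]]] := almost_invariant_weight Q (divr_gt0 e0 (ltr0Sn R 1)).
have [T hT] : exists T : nat, T.+1%:R^-1 <= eps / 2.
  exists (Num.truncn (2 / eps)).
  rewrite -[leRHS]invrK lef_pV2 ?posrE ?invr_gt0 ?divr_gt0 // invf_div.
  exact/ltW/truncnS_gt.
pose W b u := flatten [seq signed T b v | v <- block B Q a u].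
exists (Q`! * B * (Q`! * B`!) * T.+2)%N, W,
  (fun u => flatten [seq nz (wave T v) | v <- nz (core B a u)]).
have sW b b' u v : (u <= Q)%N -> (v <= Q)%N -> sdot (W b u) (W b' v) =
    sign_factor R T b b' * (Num.sqrt (u%:R * v%:R) * overlap B Q a u v).
  by move=> uQ vQ; rewrite sdot_flatten_signed ?size_block // sdot_block.
split.
- move=> b u; rewrite /W -(size_block B Q a u).
  elim: (block _ _ _ _) => //= x s IH.
  by rewrite size_cat IH size_signed mulSn.
- by move=> u v /=; rewrite core_add /nz filter_cat map_cat flatten_cat.
- by move=> b u uQ; rewrite nz_flatten_signed nz_block.
- move=> b u uQ; rewrite sW // /sign_factor eqxx mul1r -expr2 sqrtr_sqr ger0_norm //.
  have [->|u0] := posnP u; first by rewrite mul0r.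
  by rewrite overlap_id ?mulr1 // u0.
move=> b b' u v uQ vQ; rewrite sW //; set r := Num.sqrt _.
have r0 : 0 <= r by exact: sqrtr_ge0.
have [u0|u0] := posnP u; first by rewrite /r u0 mul0r sqrtr0 !mul0r !mulr0 subrr normr0.
have [v0|v0] := posnP v; first by rewrite /r v0 mulr0 sqrtr0 !mul0r !mulr0 subrr normr0.
have /andP[lo hi] : 1 - eps / 2 <= overlap B Q a u v <= 1.
  by apply: overlap_bounds => //; rewrite ?u0 ?v0.
set o := overlap _ _ _ _ _ in lo hi *.
have -> : sign_factor R T b b' * (r * o) - (-1) ^+ (b != b') * r =
    (sign_factor R T b b' * o - (-1) ^+ (b != b')) * r by ring.
rewrite normrM (ger0_norm r0) ler_wpM2r // /sign_factor; case: eqP => _ /=.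
  by rewrite expr0 mul1r ler_norml; lra.
have -> : T%:R / T.+1%:R = 1 - T.+1%:R^-1 :> R.
  by rewrite -[T.+1]addn1 natrD; field; rewrite natr1 pnatr_eq0.
have i0 : 0 <= T.+1%:R^-1 :> R by rewrite invr_ge0.
have i1 : T.+1%:R^-1 <= 1 :> R by rewrite invf_le1 // ler1n.
set i := T.+1%:R^-1 in hT i0 i1 *; rewrite expr1 ler_norml.
(* The product [(1 - i) * o] lies between [1 - i - (1 - o)] and [1]. *)
have h1 : 0 <= (1 - o) * (1 - i) by rewrite mulr_ge0 ?subr_ge0.
have h2 : 0 <= i * (1 - o) by rewrite mulr_ge0 ?subr_ge0.
by apply/andP; split; lra.
Qed.

(** * Approximating points of a sphere by Ramsey configurations *)

Lemma dirichlet_approximation (R : realType) (J : finType) (th : J -> R) (eta : R) :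
  0 < eta -> exists Q : nat, (0 < Q)%N /\
    forall k, exists z : int, `|Q%:R * th k - z%:~R| <= eta.
Proof.
have alg (a b c d : R) : a - b - (c - d) = a - c - (b - d) by ring.
move=> eta0; have [M MR] : exists M : nat, eta^-1 < M%:R.
  by exists (Num.truncn eta^-1).+1; exact: truncnS_gt.
have M0 : 0 < M%:R :> R by apply: lt_trans MR; rewrite invr_gt0.
(* Two multiples of [th] with fractional parts in the same box of side [1 / M]. *)
pose fr (q : nat) k : R := q%:R * th k - (Num.floor (q%:R * th k))%:~R.
have fr0 q k : 0 <= fr q k by rewrite subr_ge0 floor_le.
have fr1 q k : fr q k < 1 by rewrite ltrBlDl; have := floorD1_gt (q%:R * th k); rewrite intrD.
have ltM q k : (Num.truncn (M%:R * fr q k) < M)%N.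
  by rewrite truncn_lt_nat ?mulr_ge0 // gtr_pMr.
pose phi (q : 'I_(M ^ #|J|).+1) : {ffun J -> 'I_M} := [ffun k => Ordinal (ltM q k)].
have /injectivePn[p [q npq epq]] : ~~ injectiveb phi.
  apply/negP => /injectiveP/leq_card; rewrite card_ffun !card_ord ltnn //.
wlog lt : p q npq epq / (q < p)%N.
  move=> H; case: (ltngtP p q) => [||e]; last by rewrite (val_inj e) eqxx in npq.
    by apply: H; rewrite 1?eq_sym.
  exact: H.
exists (p - q)%N; split=> [|k]; first by rewrite subn_gt0.
exists (Num.floor (p%:R * th k) - Num.floor (q%:R * th k)).
have -> : (p - q)%:R * th k - (Num.floor (p%:R * th k) - Num.floor (q%:R * th k))%:~R
    = fr p k - fr q k.
  rewrite /fr (natrB _ (ltnW lt)) mulrBl intrB; exact: alg.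
have e : Num.truncn (M%:R * fr p k) = Num.truncn (M%:R * fr q k).
  by have /(congr1 (fun f : {ffun J -> 'I_M} => val (f k))) := epq; rewrite [phi p k]ffunE [phi q k]ffunE.
clear phi epq.
have /andP[lo1 hi1] := truncn_itv (mulr_ge0 (ltW M0) (fr0 p k)).
have /andP[lo2 hi2] := truncn_itv (mulr_ge0 (ltW M0) (fr0 q k)).
rewrite e in lo1 hi1; rewrite -natr1 in hi1 hi2.
have M1 : 1 < eta * M%:R by rewrite -ltr_pdivrMl // mulr1.
rewrite -(ler_pM2l M0); rewrite -[X in X * `|_|]ger0_norm ?(ltW M0) // -normrM ler_norml.
rewrite mulrBr; move: lo1 hi1 lo2 hi2 M1; set A := M%:R * fr p k; set B' := M%:R * fr q k.
by rewrite (mulrC eta) => *; apply/andP; split; lra.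
Qed.

Definition nearest (R : realType) (Q : nat) (s : R) : nat :=
  Num.truncn (Q%:R * s ^+ 2 + 2^-1).

Lemma nearest_dist (R : realType) (Q : nat) (s eta : R) (z : int) :
  eta < 2^-1 -> `|Q%:R * s ^+ 2 - z%:~R| <= eta ->
  `|Q%:R * s ^+ 2 - (nearest Q s)%:R| <= eta.
Proof.
move=> eta2 close; have ge0 : 0 <= Q%:R * s ^+ 2 by rewrite mulr_ge0 ?sqr_ge0.
have /andP[lo hi] : z%:~R <= Q%:R * s ^+ 2 + 2^-1 < (z + 1)%:~R.
  move: close; rewrite ler_norml intrD => /andP[h1 h2].
  by apply/andP; split; lra.
have z0 : 0 <= z.
  have : 0 < (z + 1)%:~R :> R by apply: le_lt_trans hi; rewrite addr_ge0 // invr_ge0.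
  by rewrite ltr0z; lia.
suff -> : nearest Q s = `|z|%N by rewrite natr_absz (ger0_norm z0).
apply/eqP; rewrite /nearest; case: z z0 lo hi {close} => // n _ lo hi.
rewrite truncn_eq ?addr_ge0 ?invr_ge0 //; apply/andP; split; first exact: lo.
by rewrite -(natr1 n); move: hi; rewrite intrD.
Qed.

(** Rounding errors below [1 / d] cannot add up to a nonzero integer: the rounded
    values satisfy exactly the integral relation that the exact ones satisfy. *)
Lemma sum_nearest (R : realType) (d Q : nat) (x : 'I_d -> R) (eta : R) :
  \sum_l x l ^+ 2 = 1 -> d%:R * eta < 1 ->
  (forall l, `|Q%:R * x l ^+ 2 - (nearest Q (x l))%:R| <= eta) ->
  (\sum_l nearest Q (x l))%N = Q.
Proof.
move=> nx small close.
have : `|Q%:R - (\sum_l nearest Q (x l))%N%:R| < 1 :> R.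
  apply: le_lt_trans small.
  have -> : Q%:R - (\sum_l nearest Q (x l))%N%:R =
      \sum_l (Q%:R * x l ^+ 2 - (nearest Q (x l))%:R) :> R.
    by rewrite sumrB -mulr_sumr nx mulr1 natr_sum.
  apply: le_trans (ler_norm_sum _ _ _) _.
  apply: le_trans (ler_sum _ (fun l _ => close l)) _.
  by rewrite sumr_const card_ord mulr_natl.
set S := (\sum_l _)%N; rewrite -[Q%:R]/(Q%:Z%:~R) -[S%:R]/(S%:Z%:~R) -intrB.
rewrite -intr_norm -[1]/(1%:~R) ltr_int; lia.
Qed.

Lemma sqrt_near (R : realType) (p s del : R) : 0 <= del -> 0 <= p ->
  `|p - s ^+ 2| <= del ^+ 2 -> `|Num.sqrt p - `|s| | <= del.
Proof.
move=> d0 p0 close; have q0 := sqrtr_ge0 p; have r0 := normr_ge0 s.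
have := sqr_sqrtr p0; set q := Num.sqrt p in q0 *; set r := `|s| in r0 *.
move=> qp; have sr : s ^+ 2 = r ^+ 2 by rewrite /r real_normK ?num_real.
rewrite -(@ler_pXn2r _ 2) ?nnegrE //; apply: le_trans close.
rewrite -qp sr subr_sqr normrM expr2 ler_wpM2l //.
by rewrite (ger0_norm (addr_ge0 q0 r0)) ler_norml; apply/andP; split; lra.
Qed.

Lemma sqdist_near (R : realType) (p p' s t sd del : R) :
  0 <= del <= 1 -> 0 <= p <= 1 -> 0 <= p' <= 1 -> s ^+ 2 <= 1 ->
  `|p - s ^+ 2| <= del ^+ 2 -> `|p' - t ^+ 2| <= del ^+ 2 ->
  `|sd - (-1) ^+ ((s < 0) != (t < 0)) * (Num.sqrt p * Num.sqrt p')| <=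
    del * (Num.sqrt p * Num.sqrt p') ->
  `|p + p' - 2 * sd - (s - t) ^+ 2| <= 8 * del.
Proof.
move=> /andP[d0 d1] /andP[p0 p1] /andP[q0 q1] s1 ps pt.
have := sqrt_near d0 p0 ps; have := sqrt_near d0 q0 pt.
have := sqrtr_ge0 p; have := sqrtr_ge0 p'.
have : Num.sqrt p <= 1 by rewrite -sqrtr1 ler_sqrt.
have : Num.sqrt p' <= 1 by rewrite -sqrtr1 ler_sqrt.
set a := Num.sqrt p; set b := Num.sqrt p'; set sg := (-1) ^+ _.
move=> b1 a1 b0 a0 tb sa close.
have st : s * t = sg * (`|s| * `|t|).
  rewrite /sg; case: (ltrP s 0) => hs; case: (ltrP t 0) => ht; rewrite /=;
  rewrite ?(ltr0_norm hs) ?(ger0_norm hs) ?(ltr0_norm ht) ?(ger0_norm ht); ring.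
have sg1 : `|sg| = 1 by rewrite normrX normrN1 expr1n.
have s1' : `|s| <= 1 by rewrite -(@ler_pXn2r _ 2) ?nnegrE // expr1n real_normK ?num_real.
have ab : `|a * b - `|s| * `|t| | <= 2 * del.
  have -> : a * b - `|s| * `|t| = (a - `|s|) * b + `|s| * (b - `|t|) by ring.
  apply: le_trans (ler_normD _ _) _; rewrite !normrM (ger0_norm b0) normr_id.
  have -> : 2 * del = del * 1 + 1 * del by ring.
  by apply: lerD; apply: ler_pM.
have sd1 : `|sd - s * t| <= 3 * del.
  have -> : sd - s * t = (sd - sg * (a * b)) + sg * (a * b - `|s| * `|t|).
    by rewrite st; ring.
  apply: le_trans (ler_normD _ _) _; rewrite [X in _ + X]normrM sg1 mul1r.
  have : del * (a * b) <= del * 1 by rewrite ler_wpM2l // mulr_ile1.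
  lra.
have d2 : del ^+ 2 <= del by rewrite expr2 ler_piMr.
have -> : p + p' - 2 * sd - (s - t) ^+ 2 =
  (p - s ^+ 2) + (p' - t ^+ 2) - 2 * (sd - s * t) by ring.
move: ps pt sd1; rewrite !ler_norml => /andP[? ?] /andP[? ?] /andP[? ?].
by apply/andP; split; lra.
Qed.

Lemma seq_sqdist_flatten_map (R : realType) (T : Type) (f g : T -> seq R) (r : seq T) :
  (forall x, size (f x) = size (g x)) ->
  seq_sqdist (flatten [seq f x | x <- r]) (flatten [seq g x | x <- r]) =
  \sum_(x <- r) seq_sqdist (f x) (g x).
Proof.
move=> szE; elim: r => [|x r IH]; first by rewrite /seq_sqdist !big_nil.
by rewrite big_cons /= -IH /seq_sqdist zip_cat // big_cat.
Qed.

Lemma sum_nz_sqr (R : realType) (s : seq R) : \sum_(v <- nz s) v ^+ 2 = sdot s s.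
Proof.
rewrite /nz big_filter; elim: s => [|v s IH]; first by rewrite /sdot !big_nil.
rewrite sdot_cons -IH big_cons -expr2; have [->|//] := eqVneq v 0.
by rewrite expr0n add0r.
Qed.

(** Write [x i l ^+ 2] as [u / Q] nearly, and let block [l] of row [i] carry [u]
    copies of the self-similar sequence, with the sign of [x i l].  Each row
    spends exactly [Q] copies, so all rows have the same nonzero entries. *)
Lemma sphere_ramsey_approx_unit (R : realType) (I : finType) (d : nat)
    (x : I -> 'I_d -> R) (eps : R) :
  (forall i, \sum_l x i l ^+ 2 = 1) -> 0 < eps ->
  exists De : R -> R -> R,
  [/\ forall s t, De s t = De t s, forall s, De s s = 0,
      forall i j l, `|De (x i l) (x j l) - (x i l - x j l) ^+ 2| <= eps &
      sphere_ramsey 1 (fun i j => \sum_l De (x i l) (x j l))].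
Proof.
move=> nx e0; pose del := Num.min 2^-1 (eps / 8).
have del0 : 0 < del by rewrite lt_min invr_gt0 ltr0n divr_gt0.
have del2 : del <= 2^-1 by rewrite ge_min lexx.
have dele : 8 * del <= eps.
  by rewrite mulrC -ler_pdivlMr // ge_min lexx orbT.
pose eta := del ^+ 2 / d.+1%:R.
have D0 : 0 < d.+1%:R :> R by rewrite ltr0n.
have eta0 : 0 < eta by rewrite divr_gt0 ?exprn_gt0.
have dd : del ^+ 2 <= 4^-1.
  have -> : 4^-1 = 2^-1 ^+ 2 :> R by field.
  by rewrite ler_pXn2r // nnegrE ?invr_ge0 ?(ltW del0).
have eta1 : eta <= del ^+ 2.
  by rewrite ler_pdivrMr // ler_peMr ?sqr_ge0 // ler1n.
have etad : d%:R * eta < 1.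
  rewrite /eta mulrA ltr_pdivrMr // mul1r.
  apply: (@le_lt_trans _ _ (d%:R * 1)); last by rewrite mulr1 ltr_nat.
  by rewrite ler_wpM2l //; lra.
have [Q [Q0 dir]] := @dirichlet_approximation R (I * 'I_d)%type
  (fun k => x k.1 k.2 ^+ 2) eta eta0.
have close i l : `|Q%:R * x i l ^+ 2 - (nearest Q (x i l))%:R| <= eta.
  have [z hz] := dir (i, l); apply: nearest_dist hz; lra.
have sumQ i : (\sum_l nearest Q (x i l))%N = Q := sum_nearest (nx i) etad (close i).
have leQ i l : (nearest Q (x i l) <= Q)%N.
  by rewrite -[leqRHS](sumQ i) (bigD1 l) //= leq_addr.
have [M [W [G [szW addG nzW normW dotW]]]] := self_similar_blocks Q del0.
pose V (s : R) := W (s < 0) (nearest Q s).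
have szV (s t : R) : size (V s) = size (V t) by rewrite !szW.
have Q0R : 0 < Q%:R :> R by rewrite ltr0n.
pose y i := flatten [seq V (x i l) | l <- index_enum 'I_d].
have G0 : G 0%N = [::].
  apply/nilP; have /(congr1 size)/eqP := addG 0%N 0%N.
  by rewrite addn0 size_cat -[X in X == _]addn0 eqn_add2l eq_sym.
have nzy i : nz (y i) = G Q.
  rewrite -(sumQ i) (big_morph G addG G0) /y; elim: (index_enum _) => [|l r IH].
    by rewrite big_nil.
  by rewrite big_cons -IH /= /nz filter_cat -(nzW (x i l < 0)).
have szy i : size (y i) = (size (index_enum 'I_d) * M)%N.
  by rewrite /y; elim: (index_enum _) => //= l r IH; rewrite size_cat IH szW.
have := sphere_ramsey_scale (Num.sqrt Q%:R^-1) (sphere_ramsey_rows szy nzy).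
rewrite -(nzW false Q (leqnn Q)) sum_nz_sqr normW // sqr_sqrtr ?invr_ge0 //.
rewrite mulVf ?gt_eqF // => SR.
exists (fun s t => Q%:R^-1 * seq_sqdist (V s) (V t)); split.
- by move=> s t; rewrite !seq_sqdist_sdot // (sdotC (szV s t)) (addrC (sdot (V s) (V s))).
- move=> s; rewrite /seq_sqdist big1_seq ?mulr0 // => p.
  by elim: (V s) => //= v r IH; rewrite in_cons => /orP[/eqP ->|/IH]//; rewrite subrr expr0n.
- move=> i j l; rewrite seq_sqdist_sdot // !normW //.
  set u := nearest Q (x i l); set v := nearest Q (x j l).
  have frac k : (nearest Q (x k l))%:R / Q%:R <= 1 :> R.
    by rewrite ler_pdivrMr // mul1r ler_nat.
  have near k : `|(nearest Q (x k l))%:R / Q%:R - x k l ^+ 2| <= del ^+ 2.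
    rewrite distrC -(ler_pM2l Q0R) -{1}[Q%:R]ger0_norm // -normrM mulrBr.
    rewrite [X in _ - X]mulrC divfK ?gt_eqF //; apply: le_trans (close k l) _.
    by apply: le_trans eta1 _; rewrite ler_peMl ?sqr_ge0 // ler1n.
  have -> : Q%:R^-1 * (u%:R + v%:R - 2 * sdot (V (x i l)) (V (x j l))) =
      u%:R / Q%:R + v%:R / Q%:R - 2 * (sdot (V (x i l)) (V (x j l)) / Q%:R) by ring.
  apply: le_trans dele; apply: sqdist_near => //.
  + by apply/andP; split; lra.
  + by rewrite divr_ge0 //=; exact: frac.
  + by rewrite divr_ge0 //=; exact: frac.
  + by rewrite -(nx i) (bigD1 l) //= lerDl sumr_ge0 // => k _; exact: sqr_ge0.
  + exact: near.
  + exact: near.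
  have -> : Num.sqrt (u%:R / Q%:R) * Num.sqrt (v%:R / Q%:R) =
      Num.sqrt (u%:R * v%:R) / Q%:R :> R.
    rewrite -sqrtrM ?divr_ge0 //.
    have -> : u%:R / Q%:R * (v%:R / Q%:R) = u%:R * v%:R * Q%:R^-1 ^+ 2 :> R by ring.
    by rewrite [LHS]sqrtrM ?mulr_ge0 // sqrtr_sqr ger0_norm ?invr_ge0.
  rewrite !mulrA -mulrBl normrM [X in _ * X]ger0_norm ?invr_ge0 //.
  by rewrite ler_wpM2r ?invr_ge0 //; exact: dotW.
apply: sphere_ramsey_ext SR => // i j.
by rewrite seq_sqdist_flatten_map // mulr_sumr.
Qed.

(** The approximate squared distance is a sum over the coordinates, in which a
    coordinate shared by two points contributes nothing: this exactness is what
    keeps the approximation of a subset of a box inside a box. *)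
Theorem sphere_ramsey_approx (R : realType) (I : finType) (d : nat)
    (x : I -> 'I_d -> R) (t eps : R) : 0 < t ->
  (forall i, \sum_l x i l ^+ 2 = t) -> 0 < eps ->
  exists De : R -> R -> R,
  [/\ forall a b, De a b = De b a, forall a, De a a = 0,
      forall i j l, `|De (x i l) (x j l) - (x i l - x j l) ^+ 2| <= eps &
      sphere_ramsey t (fun i j => \sum_l De (x i l) (x j l))].
Proof.
move=> t0 nx e0; pose r := Num.sqrt t; have r0 : 0 < r by rewrite sqrtr_gt0.
have r2 : r ^+ 2 = t by rewrite sqr_sqrtr // ltW.
have tN0 : t != 0 by rewrite gt_eqF.
have rN0 : r != 0 by rewrite gt_eqF.
have [|De [sym De0 close SR]] :=
    @sphere_ramsey_approx_unit R I d (fun i l => x i l / r) (eps / t) _ (divr_gt0 e0 t0).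
  by move=> i; under eq_bigr do rewrite expr_div_n; rewrite -mulr_suml nx r2 divff.
exists (fun a b => t * De (a / r) (b / r)); split.
- by move=> a b; rewrite sym.
- by move=> a; rewrite De0 mulr0.
- move=> i j l.
  have -> : (x i l - x j l) ^+ 2 = t * (x i l / r - x j l / r) ^+ 2.
    by rewrite -mulrBl expr_div_n r2 mulrC divfK.
  rewrite -mulrBr normrM (ger0_norm (ltW t0)) -ler_pdivlMl // [leRHS]mulrC.
  exact: close.
apply: sphere_ramsey_ext (sphere_ramsey_scale r SR) => [|i j]; first by rewrite r2 mulr1.
by rewrite r2 mulr_sumr.
Qed.

(** * Rectangular configurations *)

Lemma mul_row_trmx (R : realType) (n : nat) (r s : 'rV[R]_n) :
  (r *m s^T) 0 0 = \sum_l r 0 l * s 0 l.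
Proof. by rewrite mxE; apply: eq_bigr => l _; rewrite mxE. Qed.

Lemma mul_row_trmx_ge0 (R : realType) (n : nat) (r : 'rV[R]_n) :
  0 <= (r *m r^T) 0 0.
Proof. by rewrite mul_row_trmx sumr_ge0 // => l _; rewrite -expr2 sqr_ge0. Qed.

Lemma mulmx_trmx_eq0 (R : realType) (m n : nat) (A : 'M[R]_(m, n)) :
  A *m A^T = 0 -> A = 0.
Proof.
move=> A0; apply/matrixP => i j; rewrite mxE.
have /matrixP/(_ i i) := A0; rewrite !mxE => /eqP; rewrite psumr_eq0; last first.
  by move=> l _; rewrite mxE -expr2 sqr_ge0.
by move=> /allP/(_ j (mem_index_enum j)); rewrite /= mxE -expr2 sqrf_eq0 => /eqP.
Qed.

Lemma orthogonal_projection (R : realType) (m n : nat) (A : 'M[R]_(m, n))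
    (v : 'rV[R]_n) : exists u : 'rV[R]_m, (v - u *m A) *m A^T = 0.
Proof.
suff /submxP[u eu] : (v *m A^T <= A *m A^T)%MS.
  by exists u; rewrite mulmxBl eu mulmxA subrr.
apply: submx_trans (submxMl v A^T) _.
have le : (A *m A^T <= A^T)%MS by exact: submxMl.
rewrite -(mxrank_leqif_sup le) eqn_leq mxrankS //= mxrank_tr.
have kerS : (kermx (A *m A^T) <= kermx A)%MS.
  apply/sub_kermxP/mulmx_trmx_eq0; rewrite trmx_mul mulmxA -(mulmxA _ A).
  by rewrite mulmx_ker mul0mx.
have := mxrankS kerS; rewrite !mxrank_ker.
have := rank_leq_row A; have := rank_leq_row (A *m A^T); lia.
Qed.

(** The orthogonal projection of the centre of a sphere through the points
    [x i] to their affine hull is the centre of a sphere through them that is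
    no larger, and is transported by any isometry. *)
Lemma transport_center (R : realType) (I : finType) (d k : nat)
    (x : I -> 'rV[R]_d) (b : I -> 'rV[R]_k) (c : 'rV[R]_d) (s : R) : 0 <= s ->
  (forall i j, \sum_l (x i 0 l - x j 0 l) ^+ 2 = \sum_l (b i 0 l - b j 0 l) ^+ 2) ->
  (forall i, \sum_l (c 0 l - x i 0 l) ^+ 2 = s) ->
  exists (z : 'rV[R]_k) (s' : R), 0 <= s' <= s /\
    forall i, \sum_l (b i 0 l - z 0 l) ^+ 2 = s'.
Proof.
move=> s0 iso hc; case: (pickP I) => [i0 _|I0]; last first.
  by exists 0, 0; rewrite lexx s0; split=> // i; have := I0 i.
pose A := \matrix_(a < #|I|) (x (enum_val a) - x i0).
pose B := \matrix_(a < #|I|) (b (enum_val a) - b i0).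
have sq n (r : 'rV[R]_n) : \sum_l r 0 l ^+ 2 = (r *m r^T) 0 0.
  by rewrite mul_row_trmx; apply: eq_bigr => l _; rewrite expr2.
have polar n (y : I -> 'rV[R]_n) i j :
    \sum_l (y i - y i0) 0 l * (y j - y i0) 0 l =
    (\sum_l (y i 0 l - y i0 0 l) ^+ 2 + \sum_l (y j 0 l - y i0 0 l) ^+ 2
     - \sum_l (y i 0 l - y j 0 l) ^+ 2) / 2.
  by rewrite -big_split -sumrB mulr_suml; apply: eq_bigr => l _; rewrite !mxE /=; field.
have AB : A *m A^T = B *m B^T.
  apply/matrixP => a a'; rewrite [LHS]mxE [RHS]mxE.
  transitivity (\sum_l (x (enum_val a) - x i0) 0 l * (x (enum_val a') - x i0) 0 l).
    by apply: eq_bigr => l _; rewrite !mxE.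
  by rewrite polar !iso -polar; apply: eq_bigr => l _; rewrite !mxE.
have [u hu] := orthogonal_projection A (c - x i0).
pose w := c - x i0 - u *m A.
exists (b i0 + u *m B), (s - (w *m w^T) 0 0).
have key i : \sum_l (b i 0 l - (b i0 + u *m B) 0 l) ^+ 2 = s - (w *m w^T) 0 0.
  pose e := delta_mx 0 (enum_rank i) - u.
  have eA : e *m A = x i - x i0 - u *m A.
    by rewrite mulmxBl -rowE rowK enum_rankK.
  have eB : e *m B = b i - b i0 - u *m B.
    by rewrite mulmxBl -rowE rowK enum_rankK.
  transitivity ((e *m A *m (e *m A)^T) 0 0).
    transitivity ((e *m B *m (e *m B)^T) 0 0).
      by rewrite -sq eB; apply: eq_bigr => l _; rewrite !mxE opprD addrA.
    by rewrite !trmx_mul !mulmxA -!(mulmxA e) AB.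
  have -> : s = ((e *m A - w) *m (e *m A - w)^T) 0 0.
    rewrite -(hc i) -sq; apply: eq_bigr => l _.
    by rewrite eA /w !mxE; ring.
  have wA : w *m (e *m A)^T = 0 by rewrite trmx_mul mulmxA hu mul0mx.
  have Aw : e *m A *m w^T = 0.
    by rewrite -[LHS]trmxK trmx_mul trmxK wA trmx0.
  move: (e *m A) wA Aw => y wA Aw.
  rewrite [(y - w)^T]linearB /= mulmxBl !mulmxBr wA Aw subr0 sub0r opprK.
  by rewrite [in RHS]mxE addrK.
split=> //; rewrite gerBl mul_row_trmx_ge0 andbT -(key i0).
by apply: sumr_ge0 => l _; exact: sqr_ge0.
Qed.

Lemma sum_square_indicator (R : realType) (k : nat) (lam : 'I_k -> R)
    (S S' : {set 'I_k}) : (forall l, 0 <= lam l) ->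
  \sum_l (Num.sqrt (lam l) * (l \in S)%:R - Num.sqrt (lam l) * (l \in S')%:R) ^+ 2 =
  \sum_l lam l * ((l \in S) != (l \in S'))%:R.
Proof.
move=> lam0; apply: eq_bigr => l _; rewrite -mulrBr exprMn sqr_sqrtr //.
by congr (_ * _); case: (l \in S); case: (l \in S'); rewrite /= ?subrr ?expr0n //;
  rewrite ?subr0 ?sub0r ?sqrrN expr1n.
Qed.

(** Two points of the configuration agree in every coordinate outside the
    symmetric difference of their vertex labels, and an approximating
    configuration does so as well: it is again a subset of a box.  Made slightly
    too small, it is corrected by one two-point block per edge of the box. *)
Lemma sphere_ramsey_box (R : realType) (I : finType) (k : nat)
    (S : I -> {set 'I_k}) (lam z : 'I_k -> R) (s h2 : R) :
  (forall l, 0 < lam l) -> 0 <= s < h2 ->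
  (forall i, \sum_l (Num.sqrt (lam l) * (l \in S i)%:R - z l) ^+ 2 = s) ->
  sphere_ramsey h2 (fun i j => \sum_l lam l * ((l \in S i) != (l \in S j))%:R).
Proof.
move=> lam0 /andP[s0 sh] hs; pose t := (s + h2) / 2.
have st : s < t by rewrite /t; lra.
have th : t < h2 by rewrite /t; lra.
pose La := \sum_l lam l; have La0 : 0 <= La by rewrite sumr_ge0 // => l _; exact: ltW.
pose del := Num.min 2^-1 ((h2 - t) / (La + 1)).
have La1 : 0 < La + 1 by lra.
have del0 : 0 < del by rewrite lt_min invr_gt0 ltr0n divr_gt0 // subr_gt0.
have del2 : del <= 2^-1 by rewrite ge_min lexx.
have delh : del * La <= h2 - t.
  have : del * (La + 1) <= h2 - t by rewrite -ler_pdivlMr // ge_min lexx orbT.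
  by apply: le_trans; rewrite ler_wpM2l ?(ltW del0) // lerDl.
(* The scaling factor that makes the approximating box too small. *)
pose g := Num.sqrt (1 - del); have g2 : g ^+ 2 = 1 - del by rewrite sqr_sqrtr; lra.
pose mu := \big[Num.min/1]_l lam l.
have mu0 : 0 < mu by rewrite /mu; elim/big_ind: _ => // a b a0 b0; rewrite lt_min a0.
have mulam l : mu <= lam l by rewrite /mu (bigD1 l) //= ge_min lexx.
pose v (b : bool) l := g * (Num.sqrt (lam l) * b%:R - z l).
(* The extra coordinate, equal for all points, makes the squared radius [t] before scaling. *)
pose y i (l : 'I_k.+1) := if unlift ord0 l is Some l' then v (l' \in S i) l'
  else g * Num.sqrt (t - s).
have y0 i : y i ord0 = g * Num.sqrt (t - s) by rewrite /y unlift_none.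
have yS i l : y i (lift ord0 l) = v (l \in S i) l by rewrite /y liftK.
have ny i : \sum_l y i l ^+ 2 = g ^+ 2 * t.
  rewrite big_ord_recl y0 exprMn (@sqr_sqrtr _ (t - s)) ?subr_ge0 ?ltW //.
  under eq_bigr do rewrite yS /v exprMn.
  by rewrite -mulr_sumr hs -(mulrDr (g ^+ 2)) subrK.
have t0 : 0 < g ^+ 2 * t by rewrite g2 mulr_gt0 //; lra.
have [De [sym De0 close SR]] := sphere_ramsey_approx t0 ny (mulr_gt0 del0 mu0).
(* [close] bounds the distance of two values only if both are attained. *)
pose E l := if [exists i, exists j, (l \in S i) && (l \notin S j)]
  then lam l - De (v true l) (v false l) else 0.
have Eb l : 0 <= E l <= 2 * (del * lam l).
  have lam0' := lam0 l; have dl : 0 <= del * lam l by rewrite mulr_ge0 ?ltW.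
  rewrite /E; case: existsP => [[i /existsP[j /andP[Si Sj]]]|_]; last by rewrite lexx mulr_ge0.
  have := close i j (lift ord0 l); rewrite !yS Si (negbTE Sj).
  have -> : (v true l - v false l) ^+ 2 = (1 - del) * lam l.
    rewrite -g2 -[in RHS](@sqr_sqrtr _ (lam l)) ?ltW // /v /= mulr1 mulr0; ring.
  have : del * mu <= del * lam l by rewrite ler_wpM2l // ltW.
  by rewrite ler_norml => ? /andP[? ?]; apply/andP; split; lra.
have E0 l : 0 <= E l by case/andP: (Eb l).
have SR' := sphere_ramsey_partitions (fun l i => l \in S i) E0 SR.
apply: sphere_ramsey_pad (sphere_ramsey_ext erefl _ SR').
  have : \sum_l E l <= 2 * (del * La).
    by rewrite /La !mulr_sumr ler_sum // => l _; case/andP: (Eb l).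
  have : 0 <= del * t by rewrite mulr_ge0 ?ltW //; lra.
  rewrite g2; lra.
move=> i j /=; rewrite big_ord_recl !y0 De0 add0r -big_split; apply: eq_bigr => l _ /=.
rewrite !yS; have [<-|ne] := eqVneq (l \in S i) (l \in S j).
  by rewrite De0 !mulr0 addr0.
rewrite !mulr1 /E; case: ifPn => [_|/existsPn nE].
  by case: (l \in S i) (l \in S j) ne => -[] // _; rewrite ?(sym (v false l)) addrC subrK.
exfalso; case Si: (l \in S i) ne => /=; case Sj: (l \in S j) => // _.
  by have /existsPn/(_ j) := nE i; rewrite Si Sj.
by have /existsPn/(_ i) := nE j; rewrite Si Sj.
Qed.

(** * Simplices *)

(** Identifying the points [i] and [j] turns the regular simplex on [I] into a
    degenerate one, whose metric differs from that of the regular simplex only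
    at the pair [i, j]: these metrics generate a neighbourhood of the regular one. *)
Lemma sphere_ramsey_near_regular (R : realType) (I : finType) (t ka : R)
    (D E : I -> I -> R) :
  sphere_ramsey t D -> (forall i j, E i j = E j i) -> (forall i, E i i = 0) ->
  (forall i j, i != j -> E i j <= ka) ->
  (\sum_i \sum_(j | i != j) (ka - E i j)) / 2 <= ka ->
  sphere_ramsey (t + ka / 2) (fun i j => D i j + E i j).
Proof.
move=> SR sym E0 leE sumE.
pose nu (p : I * I) : R := (p.1 != p.2)%:R * (ka - E p.1 p.2).
have nu0 p : 0 <= nu p / 2.
  rewrite /nu; case: eqP => [_|/eqP/leE] /=; first by rewrite !mul0r.
  by rewrite mul1r => ?; rewrite divr_ge0 // subr_ge0.
have snu : \sum_p nu p / 2 = (\sum_i \sum_(j | i != j) (ka - E i j)) / 2.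
  rewrite -mulr_suml; congr (_ / _); rewrite -(pair_bigA _ (fun i j => nu (i, j))) /=.
  apply: eq_bigr => i _; rewrite [RHS]big_mkcond /=; apply: eq_bigr => j _.
  by rewrite /nu /=; case: eqP => _; rewrite ?mul0r ?mul1r.
pose g (p : I * I) k := if k == p.2 then p.1 else k.
have ka0 : 0 <= ka - \sum_p nu p / 2 by rewrite subr_ge0 snu.
apply: sphere_ramsey_ext (sphere_ramsey_prod (sphere_ramsey_partitions g nu0 SR)
  (sphere_ramsey_partition id ka0)); first by field.
move=> k l /=; rewrite -addrA; congr (_ + _).
have [->|kl] := eqVneq k l.
  rewrite E0 mulr0 addr0 big1 // => p _; by rewrite eqxx mulr0.
rewrite mulr1.
have gE p : (g p k != g p l)%:R = 1 - (p == (k, l))%:R - (p == (l, k))%:R :> R.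
  case: p => i j; rewrite /g /= !xpair_eqE.
  have [kj|kj] := eqVneq k j.
    rewrite -kj (eq_sym l k) (negbTE kl) andbF andbT.
    by case: (i == l); rewrite /= !subr0 ?subrr.
  rewrite (eq_sym j l) andbF subr0.
  have [lj|lj] := eqVneq l j; last by rewrite kl andbF subr0.
  by rewrite andbT (eq_sym i k); case: (k == i); rewrite /= ?subrr ?subr0.
have pick q : \sum_p nu p / 2 * (p == q)%:R = nu q / 2.
  by rewrite (bigD1 q) //= eqxx mulr1 big1 ?addr0 // => p /negbTE ->; rewrite mulr0.
under eq_bigr do rewrite gE 2!mulrBr mulr1.
by rewrite !sumrB !pick /nu /= (eq_sym l) kl (sym l k) mul1r; field.
Qed.

Lemma sum_gram (R : realType) (m n : nat) (Y : 'M[R]_(m, n)) i j :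
  \sum_l (Y i l - Y j l) ^+ 2 =
  (Y *m Y^T) i i + (Y *m Y^T) j j - 2 * (Y *m Y^T) i j.
Proof.
rewrite !mxE mulr_sumr -big_split -sumrB; apply: eq_bigr => l _.
by rewrite !mxE /=; ring.
Qed.

(** The Gram matrix of the vertices, seen from a point off their affine
    hull, is invertible; lowering its diagonal slightly
    shortens all edges by the same amount, to first order.  The difference with
    an approximation of the shrunken simplex is then nearly regular. *)
Lemma sphere_ramsey_simplex (R : realType) (m d : nat) (x : 'I_m -> 'rV[R]_d)
    (c : 'rV[R]_d) (s h2 : R) : affinely_independent x -> 0 <= s < h2 ->
  (forall i, \sum_l (c 0 l - x i 0 l) ^+ 2 = s) ->
  sphere_ramsey h2 (fun i j => \sum_l (x i 0 l - x j 0 l) ^+ 2).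
Proof.
move=> indep /andP[s0 sh] hs; pose t := (s + h2) / 2.
have st : s < t by rewrite /t; lra.
have th : t < h2 by rewrite /t; lra.
pose tau := Num.sqrt (t - s).
have tau0 : 0 < tau by rewrite sqrtr_gt0 subr_gt0.
have tau2 : tau ^+ 2 = t - s by rewrite sqr_sqrtr // subr_ge0 ltW.
pose C := row_mx (\matrix_i (x i - c)) (const_mx tau : 'M[R]_(m, 1)).
have CE i l : C i l = match split l with inl l' => x i 0 l' - c 0 l' | inr _ => tau end.
  by rewrite mxE; case: split => l'; rewrite !mxE.
have diffC i j : \sum_l (C i l - C j l) ^+ 2 = \sum_l (x i 0 l - x j 0 l) ^+ 2.
  rewrite big_split_ord /= [X in _ + X]big1 ?addr0; last first.
    by move=> l _; rewrite !CE (unsplitK (inr l)) subrr expr0n.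
  by apply: eq_bigr => l _; rewrite !CE (unsplitK (inl l)); congr (_ ^+ 2); ring.
have CC i : (C *m C^T) i i = t.
  rewrite mxE (eq_bigr (fun l => C i l ^+ 2)); last first.
    by move=> l _; rewrite [X in _ * X]mxE expr2.
  rewrite big_split_ord /= big_ord1 CE (unsplitK (inr ord0)) tau2.
  rewrite (eq_bigr (fun l => (c 0 l - x i 0 l) ^+ 2)); first by rewrite hs addrC subrK.
  by move=> l _; rewrite CE (unsplitK (inl l)); ring.
have freeC : row_free C.
  apply: inj_row_free => v vC.
  have vsum : \sum_i v 0 i = 0.
    have /matrixP/(_ 0 (rshift d ord0)) := vC; rewrite !mxE.
    under eq_bigr do rewrite CE (unsplitK (inr ord0)).
    by rewrite -mulr_suml => /eqP; rewrite mulf_eq0 (gt_eqF tau0) orbF => /eqP.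
  have vx : \sum_i v 0 i *: x i = 0.
    apply/rowP => l; have /matrixP/(_ 0 (lshift 1 l)) := vC; rewrite !mxE.
    under eq_bigr do rewrite CE (unsplitK (inl l)) mulrBr.
    rewrite sumrB -mulr_suml vsum mul0r subr0 => E.
    by rewrite summxE -[RHS]E; apply: eq_bigr => i _; rewrite mxE.
  by apply/rowP => i; rewrite mxE; exact: (indep (fun i => v 0 i) vsum vx i).
(* With [C *m B = 1], moving [C] by [- be *: B^T] changes the Gram matrix by
   [- (2 * be)%:M] to first order. *)
have [B CB] := row_freeP freeC.
pose P := B^T *m B.
have Psym i j : P i j = P j i.
  by rewrite -[in RHS](trmxK P) /P trmx_mul trmxK [RHS]mxE.
pose p := \sum_i \sum_j `|P i j| + 1.
have pge i j : `|P i j| <= p.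
  rewrite /p (bigD1 i) //= (bigD1 j) //=.
  have : 0 <= \sum_(k | k != j) `|P i k| by rewrite sumr_ge0.
  have : 0 <= \sum_(k | k != i) \sum_l `|P k l|.
    by rewrite sumr_ge0 // => k _; rewrite sumr_ge0.
  lra.
have p1 : 1 <= p by rewrite lerDr sumr_ge0 // => i _; rewrite sumr_ge0.
pose mm : R := (m * m)%:R + 1; have mm1 : 1 <= mm by rewrite lerDr.
pose be := Num.min (mm * p)^-1 (Num.min ((h2 - t) / 2) (t / 4)).
have be0 : 0 < be.
  by rewrite !lt_min invr_gt0 mulr_gt0 ?divr_gt0 ?subr_gt0 //; lra.
have beh : 2 * be <= h2 - t.
  by rewrite mulrC -ler_pdivlMr // /be ge_min [X in _ || X]ge_min lexx orbT.
have bet : 4 * be <= t.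
  by rewrite mulrC -ler_pdivlMr // /be ge_min [X in _ || X]ge_min lexx !orbT.
have bep : be * (mm * p) <= 1.
  by rewrite -ler_pdivlMr ?mulr_gt0 ?div1r ?ge_min ?lexx //; lra.
(* Private coordinates that restore equal norms, disturbed to second order. *)
pose r i := Num.sqrt (be ^+ 2 * (p - P i i)).
have r2 i : r i ^+ 2 = be ^+ 2 * (p - P i i).
  rewrite sqr_sqrtr // mulr_ge0 ?sqr_ge0 // subr_ge0.
  exact: le_trans (ler_norm _) (pge i i).
pose Y := row_mx (C - be *: B^T) (diag_mx (\row_i r i)).
have YY : Y *m Y^T = C *m C^T - (2 * be)%:M + be ^+ 2 *: P
    + diag_mx (\row_i (be ^+ 2 * (p - P i i))).
  have BC : B^T *m C^T = 1%:M by rewrite -trmx_mul CB trmx1.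
  rewrite /Y tr_row_mx mul_row_col tr_diag_mx mulmx_diag; congr (_ + _); last first.
    by congr diag_mx; apply/rowP => i; rewrite [LHS]mxE [RHS]mxE -r2 mxE expr2.
  have -> : (C - be *: B^T)^T = C^T - be *: B by apply/matrixP => i j; rewrite !mxE.
  rewrite mulmxBl !mulmxBr -!scalemxAl -!scalemxAr.
  rewrite CB BC scalerA -expr2 -/P scale_scalar_mx mulr1.
  rewrite opprB addrA.
  have -> : (2 * be)%:M = be%:M + be%:M :> 'M[R]_m by rewrite -raddfD /= mulr2n mulrDl mul1r.
  by rewrite opprD !addrA [LHS]addrAC.
have YYii i : (Y *m Y^T) i i = t - 2 * be + be ^+ 2 * p.
  rewrite YY; move: (CC i); move: (C *m C^T) (P) => G' P' E.
  by rewrite !mxE eqxx !mulr1n E; ring.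
have YYij i j : i != j -> (Y *m Y^T) i j = (C *m C^T) i j + be ^+ 2 * P i j.
  move=> ij; rewrite YY; move: (C *m C^T) (P) => G' P'.
  by rewrite !mxE (negbTE ij) !mulr0n subr0 addr0.
pose n' := (d + 1 + m)%N; pose eps := be / (mm * (n'%:R + 1)).
have n0 : 0 < n'%:R + 1 :> R by rewrite ltr_wpDl.
have eps0 : 0 < eps by rewrite divr_gt0 // mulr_gt0 //; lra.
have epsn : mm * (n'%:R * eps) <= be.
  have -> : be = mm * ((n'%:R + 1) * eps).
    have mN0 : mm != 0 by rewrite gt_eqF //; lra.
    by rewrite /eps; field; rewrite mN0 gt_eqF.
  apply: ler_wpM2l; first lra.
  by rewrite ler_wpM2r ?(ltW eps0) // lerDl.
have ny i : \sum_l Y i l ^+ 2 = t - 2 * be + be ^+ 2 * p.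
  by rewrite -(YYii i) mxE; apply: eq_bigr => l _; rewrite [X in _ = _ * X]mxE expr2.
have b2p : be ^+ 2 * p * mm <= be.
  have -> : be ^+ 2 * p * mm = be * (be * (mm * p)) by ring.
  by rewrite ler_piMr ?(ltW be0).
have b2p0 : 0 <= be ^+ 2 * p by rewrite mulr_ge0 ?sqr_ge0 //; lra.
have t'0 : 0 < t - 2 * be + be ^+ 2 * p by lra.
have [De [sym De0 close SR]] := sphere_ramsey_approx t'0 ny eps0.
pose A i j := \sum_l De (Y i l) (Y j l).
have Aclose i j : `|A i j - \sum_l (Y i l - Y j l) ^+ 2| <= n'%:R * eps.
  rewrite -sumrB; apply: le_trans (ler_norm_sum _ _ _) _.
  apply: le_trans (ler_sum _ (fun l _ => close i j l)) _.
  by rewrite sumr_const card_ord mulr_natl.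
pose E i j := \sum_l (x i 0 l - x j 0 l) ^+ 2 - A i j.
pose ka := 4 * be + n'%:R * eps.
have ne0 : 0 <= n'%:R * eps by rewrite mulr_ge0 // ltW.
have Eb i j : i != j -> ka - (4 * (be ^+ 2 * p) + 2 * (n'%:R * eps)) <= E i j <= ka.
  move=> ij; have := Aclose i j; rewrite sum_gram !YYii YYij // /E -diffC sum_gram !CC.
  have : `|be ^+ 2 * P i j| <= be ^+ 2 * p.
    by rewrite normrM ger0_norm ?sqr_ge0 // ler_wpM2l ?sqr_ge0.
  rewrite /ka !ler_norml => /andP[? ?] /andP[? ?].
  by apply/andP; split; lra.
have near := @sphere_ramsey_near_regular R 'I_m _ ka A E SR.
apply: (sphere_ramsey_pad _ (sphere_ramsey_ext erefl _ (near _ _ _ _))).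
- rewrite /ka.
  have : n'%:R * eps <= be.
    by apply: le_trans epsn; rewrite ler_peMl.
  have : be ^+ 2 * p <= be by apply: le_trans b2p; rewrite ler_peMr.
  lra.
- by move=> i j; rewrite /E addrC subrK.
- move=> i j; rewrite /E /A; congr (_ - _); apply: eq_bigr => l _; last exact: sym.
  by rewrite -sqrrN opprB.
- move=> i; rewrite /E /A !big1 ?subrr // => l _; by rewrite ?De0 ?subrr ?expr0n.
- by move=> i j /Eb/andP[].
pose de := 4 * (be ^+ 2 * p) + 2 * (n'%:R * eps).
have de0 : 0 <= de by rewrite /de; lra.
have : \sum_i \sum_(j | i != j) (ka - E i j) <= \sum_(i < m) \sum_(j < m) de.
  apply: ler_sum => i _; rewrite [leRHS](bigID (fun j => i != j)) /=.
  rewrite -[leLHS]addr0 lerD ?sumr_ge0 // ler_sum // => j /Eb.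
  by rewrite -/de => /andP[? ?]; lra.
rewrite !sumr_const card_ord -mulrnA -[de *+ _]mulr_natr.
have : de * (m * m)%:R <= 4 * (be ^+ 2 * p * mm) + 2 * (mm * (n'%:R * eps)).
  have -> : 4 * (be ^+ 2 * p * mm) + 2 * (mm * (n'%:R * eps)) = de * mm.
    by rewrite /de; ring.
  by rewrite ler_wpM2l // /mm lerDl.
rewrite /ka; lra.
Qed.

Local Open Scope classical_set_scope.
Local Open Scope ring_scope.

(** * From spheres to colourings of Euclidean space *)

Section Euclid.
Variables (R : realType) (n : nat).
Implicit Types (u v x y : 'rV[R]_n) (a : R).

Lemma dotpC u v : dotp u v = dotp v u.
Proof. by apply: eq_bigr => i _; rewrite mulrC. Qed.

Lemma dotpDZl u v x a : dotp (u + a *: v) x = dotp u x + a * dotp v x.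
Proof.
by rewrite /dotp mulr_sumr -big_split; apply: eq_bigr => i _; rewrite !mxE /=; ring.
Qed.

Lemma dotpDZr u v x a : dotp x (u + a *: v) = dotp x u + a * dotp x v.
Proof. by rewrite dotpC dotpDZl !(dotpC x). Qed.

Lemma dotpBl u v x : dotp (u - v) x = dotp u x - dotp v x.
Proof. by rewrite -scaleN1r dotpDZl mulN1r. Qed.

Lemma dotp0l u : dotp 0 u = 0.
Proof. by rewrite /dotp big1 // => i _; rewrite mxE mul0r. Qed.

Lemma dotp_ge0 u : 0 <= dotp u u.
Proof. by apply: sumr_ge0 => i _; rewrite -expr2 sqr_ge0. Qed.

Lemma dotp_eq0 u : dotp u u = 0 -> u = 0.
Proof.
move/eqP; rewrite psumr_eq0 => [/allP H|i _]; last by rewrite -expr2 sqr_ge0.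
apply/rowP => i; have := H i (mem_index_enum i).
by rewrite /= -expr2 sqrf_eq0 mxE => /eqP.
Qed.

Lemma edistE x y : edist x y = Num.sqrt (dotp (x - y) (x - y)).
Proof. by congr Num.sqrt; apply: eq_bigr => i _; rewrite !mxE expr2. Qed.

Lemma edist_sqr x y : edist x y ^+ 2 = dotp (x - y) (x - y).
Proof. by rewrite edistE sqr_sqrtr // dotp_ge0. Qed.

Lemma edistC x y : edist x y = edist y x.
Proof. by congr Num.sqrt; apply: eq_bigr => i _; rewrite -sqrrN opprB. Qed.

Lemma edist_ge0 x y : 0 <= edist x y.
Proof. exact: sqrtr_ge0. Qed.

Lemma edist_eq0 x y : edist x y = 0 -> x = y.
Proof.
move=> e; apply/eqP; rewrite -subr_eq0; apply/eqP/dotp_eq0.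
by rewrite -edist_sqr e expr0n.
Qed.

Lemma edistxx x : edist x x = 0.
Proof. by rewrite edistE subrr dotp0l sqrtr0. Qed.

Definition reflect_along (m x : 'rV[R]_n) : 'rV[R]_n :=
  x + (- (2 * dotp m x / dotp m m)) *: m.

Lemma reflect_alongB m x y :
  reflect_along m x - reflect_along m y = reflect_along m (x - y).
Proof.
rewrite /reflect_along (dotpC m (x - y)) dotpBl -!(dotpC m).
by apply/rowP => i; rewrite !mxE; ring.
Qed.

Lemma dotp_reflect_along m x y :
  dotp (reflect_along m x) (reflect_along m y) = dotp x y.
Proof.
rewrite /reflect_along dotpDZl !dotpDZr (dotpC x m).
have [->|m0] := eqVneq (dotp m m) 0; first by rewrite invr0; ring.
by field.
Qed.

(** For [v = e] the reflection is the identity, because [0^-1 = 0]. *)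
Lemma reflect_along_swap (e v : 'rV[R]_n) : dotp e e = 1 -> dotp v v = 1 ->
  reflect_along (v - e) e = v.
Proof.
move=> e1 v1; rewrite /reflect_along; set m := v - e.
have me : dotp m e = - (dotp m m / 2).
  by rewrite /m !dotpBl (dotpC v (v - e)) (dotpC e (v - e)) !dotpBl e1 v1 (dotpC e v); field.
have [/dotp_eq0 m0|m0] := eqVneq (dotp m m) 0.
  by rewrite m0 scaler0 addr0; apply/esym/eqP; rewrite -subr_eq0 -/m m0.
rewrite me; have -> : - (2 * - (dotp m m / 2) / dotp m m) = 1 by field.
by rewrite scale1r /m addrC subrK.
Qed.

End Euclid.

(** ** Triangles and their heights *)

Lemma affinely_independent_inj (R : realType) (d k : nat) (p : 'I_k -> 'rV[R]_d) :
  affinely_independent p -> injective p.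
Proof.
move=> ind i j pij; apply/eqP; apply: contraT => ij.
pose c l : R := (l == i)%:R - (l == j)%:R.
have s l0 (f : 'I_k -> 'rV[R]_d) : \sum_l (l == l0)%:R *: f l = f l0.
  rewrite (bigD1 l0) //= eqxx scale1r big1 ?addr0 // => l /negbTE ->.
  by rewrite scale0r.
have s1 l0 : \sum_(l < k) (l == l0)%:R = 1 :> R.
  by rewrite (bigD1 l0) //= eqxx big1 ?addr0 // => l /negbTE ->.
have := ind c; rewrite /c sumrB !s1 subrr => /(_ erefl).
under eq_bigr do rewrite scalerBl.
rewrite sumrB !s pij subrr => /(_ erefl)/(_ i).
by rewrite eqxx (negbTE ij) subr0 => /eqP; rewrite oner_eq0.
Qed.

Lemma triangle_base_neq (R : realType) (d : nat) (a b c : 'rV[R]_d) :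
  is_triangle [set a; b; c] -> a != b.
Proof.
move=> [p /affinely_independent_inj pinj eT]; apply/eqP => ab.
have in2 i : p i = b \/ p i = c.
  have : [set a; b; c] (p i) by rewrite eT; exists i.
  by rewrite ab => -[[]|]; [left|left|right].
have neq i j : i != j -> p i = p j -> False by move=> ij /pinj e; rewrite e eqxx in ij.
case: (in2 (@Ordinal 3 0 isT)) => e0; case: (in2 (@Ordinal 3 1 isT)) => e1;
  case: (in2 (@Ordinal 3 2 isT)) => e2;
  by [apply: (neq (@Ordinal 3 0 isT) (@Ordinal 3 1 isT)); rewrite ?e0 ?e1
     |apply: (neq (@Ordinal 3 0 isT) (@Ordinal 3 2 isT)); rewrite ?e0 ?e2
     |apply: (neq (@Ordinal 3 1 isT) (@Ordinal 3 2 isT)); rewrite ?e1 ?e2].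
Qed.

Lemma foot_of_height (R : realType) (d : nat) (a b c : 'rV[R]_d) (h : R) :
  a != b -> dist_to_set c (line a b) = h ->
  exists t : R, edist c a ^+ 2 = h ^+ 2 + t ^+ 2 * edist a b ^+ 2 /\
                edist c b ^+ 2 = h ^+ 2 + (1 - t) ^+ 2 * edist a b ^+ 2.
Proof.
move=> ab; pose v := b - a; pose e := c - a.
have vv : dotp v v != 0.
  by apply: contra_neq ab => /dotp_eq0/eqP; rewrite subr_eq0 => /eqP ->.
pose t := dotp e v / dotp v v.
have pyth r : edist c (a + r *: v) ^+ 2 =
    edist c (a + t *: v) ^+ 2 + (t - r) ^+ 2 * dotp v v.
  have E q : edist c (a + q *: v) ^+ 2 =
      dotp e e - 2 * q * dotp e v + q ^+ 2 * dotp v v.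
    rewrite edist_sqr; have -> : c - (a + q *: v) = e + (- q) *: v.
      by rewrite scaleNr opprD addrA.
    by rewrite dotpDZl !dotpDZr (dotpC v e); ring.
  by rewrite !E /t; field.
have hE : dist_to_set c (line a b) = edist c (a + t *: v).
  apply/eqP; rewrite eq_le /dist_to_set; apply/andP; split.
    apply: ge_inf; last by exists (a + t *: v) => //; exists t.
    by exists 0 => _ [q _ <-]; exact: edist_ge0.
  apply: lb_le_inf; first by exists (edist c (a + t *: v)), (a + t *: v) => //; exists t.
  move=> _ [_ [r ->] <-]; rewrite -(@ler_pXn2r _ 2) ?nnegrE ?edist_ge0 // (pyth r).
  by rewrite lerDl mulr_ge0 ?sqr_ge0 ?dotp_ge0.
rewrite hE => <-; exists t; rewrite (edistC a b) (edist_sqr b a) -/v.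
have := pyth 0; rewrite scale0r addr0 subr0 => ->.
have := pyth 1; rewrite scale1r addrC subrK => ->; split=> //.
by rewrite -(sqrrN (t - 1)) opprB.
Qed.

(** ** Copies of a configuration *)

Lemma monochromatic_copy (R : realType) (I : finType) (d n r : nat)
    (x : I -> 'rV[R]_d) (p : I -> 'rV[R]_n) (chi : 'rV[R]_n -> 'I_r) :
  (forall i j, edist (p i) (p j) = edist (x i) (x j)) ->
  (forall i j, chi (p i) = chi (p j)) ->
  exists K, congruent (range x) K /\ monochromatic chi K.
Proof.
move=> iso mono; pose g y := if [pick i | x i == y] is Some i then p i else 0.
have gx i : exists2 j, x j = x i & g (x i) = p j.
  rewrite /g; case: pickP => [j /eqP e|/(_ i)]; first by exists j.
  by rewrite eqxx.
exists (g @` range x); split.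
  exists g => // _ _ [i _ <-] [j _ <-].
  by have [i' <- ->] := gx i; have [j' <- ->] := gx j; rewrite iso.
move=> _ _ [_ [i _ <-] <-] [_ [j _ <-] <-].
by have [i' _ ->] := gx i; have [j' _ ->] := gx j; exact: mono.
Qed.

Lemma rainbow_copy (R : realType) (d n r : nat) (a b c : 'rV[R]_d)
    (A B C : 'rV[R]_n) (chi : 'rV[R]_n -> 'I_r) :
  edist A B = edist a b -> edist C A = edist c a -> edist C B = edist c b ->
  chi A != chi B -> chi C != chi A -> chi C != chi B ->
  exists K, congruent [set a; b; c] K /\ rainbow chi K.
Proof.
move=> eAB eCA eCB nAB nCA nCB.
have ne (u v : 'rV[R]_n) (u' v' : 'rV[R]_d) :
    edist u v = edist u' v' -> chi u != chi v -> (u' == v') = false.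
  move=> e; apply: contra_neqF => /eqP uv; congr chi; apply: edist_eq0.
  by rewrite e uv edistxx.
have ba : (b == a) = false by rewrite eq_sym; exact: ne eAB nAB.
have ca := ne _ _ _ _ eCA nCA; have cb := ne _ _ _ _ eCB nCB.
pose f y := if y == a then A else if y == b then B else C.
have fa : f a = A by rewrite /f eqxx.
have fb : f b = B by rewrite /f ba eqxx.
have fc : f c = C by rewrite /f ca cb.
exists (f @` [set a; b; c]); split.
  exists f => // y z [[->|->]|->] [[->|->]|->]; rewrite ?fa ?fb ?fc ?edistxx //;
    by rewrite edistC ?eAB ?eCA ?eCB edistC.
move=> _ _ [y Ty <-] [z Tz <-] e; congr f; move: Ty Tz e.
move=> [[->|->]|->] [[->|->]|->]; rewrite ?fa ?fb ?fc // => /eqP; rewrite 1?eq_sym.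
all: by rewrite ?(negbTE nAB) ?(negbTE nCA) ?(negbTE nCB) 1?eq_sym ?(negbTE nAB)
  ?(negbTE nCA) ?(negbTE nCB).
Qed.

Lemma dotp_row_mx (R : realType) (n1 n2 : nat) (u u' : 'rV[R]_n1) (v v' : 'rV[R]_n2) :
  dotp (row_mx u v) (row_mx u' v') = dotp u u' + dotp v v'.
Proof.
rewrite /dotp big_split_ord /=.
by congr (_ + _); apply: eq_bigr => i _; rewrite ?row_mxEl ?row_mxEr.
Qed.

Lemma edist_row_mx (R : realType) (n1 n2 : nat) (u u' : 'rV[R]_n1) (v v' : 'rV[R]_n2) :
  edist (row_mx u v) (row_mx u' v') ^+ 2 = edist u u' ^+ 2 + edist v v' ^+ 2.
Proof. by rewrite !edist_sqr opp_row_mx add_row_mx dotp_row_mx. Qed.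

(** If points at distance [s] always have the same colour then a coordinate
    hyperplane is monochromatic: its points at distance at most [2 * s] are joined
    by a path of two steps of length [s] through a point off the hyperplane. *)
Lemma constant_on_hyperplane (R : realType) (n : nat) (C : Type)
    (chi : 'rV[R]_(n + 1) -> C) (s : R) : 0 < s ->
  (forall A B, edist A B = s -> chi A = chi B) ->
  forall y : 'rV[R]_n, chi (row_mx y 0) = chi (row_mx 0 0).
Proof.
move=> s0 same y.
have two (p q : 'rV[R]_n) : dotp (p - q) (p - q) <= 4 * s ^+ 2 ->
    chi (row_mx p 0) = chi (row_mx q 0).
  move=> le; pose w := s ^+ 2 - dotp (p - q) (p - q) / 4.
  have w0 : 0 <= w by rewrite /w; lra.
  pose M : 'rV[R]_(n + 1) := row_mx (2^-1 *: (p + q)) (const_mx (Num.sqrt w)).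
  have side (z : 'rV[R]_n) : dotp (z - 2^-1 *: (p + q)) (z - 2^-1 *: (p + q)) =
      dotp (p - q) (p - q) / 4 -> edist (row_mx z 0) M = s.
    move=> hz; apply/eqP; rewrite -(@eqrXn2 _ 2) ?edist_ge0 ?(ltW s0) //.
    have last1 : edist (0 : 'rV[R]_1) (const_mx (Num.sqrt w)) ^+ 2 = w.
      by rewrite edist_sqr /dotp big_ord1 !mxE sub0r mulrNN -expr2 sqr_sqrtr.
    by rewrite edist_row_mx last1 edist_sqr hz /w addrC subrK.
  transitivity (chi M); [apply: same|symmetry; apply: same]; apply: side.
    by rewrite /dotp mulr_suml; apply: eq_bigr => i _; rewrite !mxE; field.
  by rewrite /dotp mulr_suml; apply: eq_bigr => i _; rewrite !mxE; field.
have [k hk] : exists k : nat, dotp y y / (4 * s ^+ 2) <= k.+1%:R.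
  exists (Num.truncn (dotp y y / (4 * s ^+ 2))); exact/ltW/truncnS_gt.
pose K : R := k.+1%:R; have K0 : 0 < K by rewrite ltr0n.
have s40 : 0 < 4 * s ^+ 2 by rewrite mulr_gt0 ?exprn_gt0.
have step j : chi (row_mx ((j%:R / K) *: y) 0) = chi (row_mx 0 0).
  elim: j => [|j <-]; first by rewrite mul0r scale0r.
  apply: two; rewrite -scalerBl -mulrBl -natr1 addrC addrA addNr add0r mul1r.
  rewrite -[K^-1 *: y]add0r dotpDZl !dotpDZr.
  rewrite (dotpC y 0) !dotp0l mulr0 !add0r.
  rewrite mulrA -invfM mulrC ler_pdivrMr ?mulr_gt0 //.
  move: hk; rewrite ler_pdivrMr // -/K => hk; apply: le_trans hk _.
  rewrite mulrC ler_wpM2l ?(ltW s40) // ler_peMl ?(ltW K0) // /K ler1n //.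
by have := step k.+1; rewrite divff ?scale1r // gt_eqF.
Qed.

(** If [A] and [B] have different colours and lie at the distance of the base, the
    apices of the triangles congruent to [T] on [A] and [B] form a sphere of radius
    [h] around the foot of the height.  Without a rainbow triangle, only two
    colours occur on it, whatever [r] is. *)
Lemma sphere_ramsey_gr_arrow (R : realType) (I : finType) (d : nat)
    (x : I -> 'rV[R]_d) (h : R) : 0 < h ->
  sphere_ramsey (h ^+ 2) (fun i j => \sum_l (x i 0 l - x j 0 l) ^+ 2) ->
  exists n : nat, forall (m : nat) (T : set 'rV[R]_m),
    is_triangle T -> has_height T h ->
    forall r : nat, (0 < r)%N -> gr_arrow n r (range x) T.
Proof.
move=> h0 SR; have [J [K [w [nw mono]]]] := SR bool.
pose n := #|J|; pose pt k : 'rV[R]_n := \row_a w k (enum_val a).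
have reind (f : J -> R) : \sum_(a < n) f (enum_val a) = \sum_j f j.
  by rewrite [RHS](reindex (@enum_val J J)) //; apply: onW_bij; exact: enum_val_bij.
have npt k : dotp (pt k) (pt k) = h ^+ 2.
  by rewrite -(nw k) -reind; apply: eq_bigr => a _; rewrite mxE expr2.
have dpt k k' : edist (pt k) (pt k') = Num.sqrt (sqdist (w k) (w k')).
  by rewrite /sqdist -reind; congr Num.sqrt; apply: eq_bigr => a _; rewrite !mxE.
pose io k : 'rV[R]_(n + 1) := row_mx (pt k) 0.
have dio k k' : edist (io k) (io k') = edist (pt k) (pt k').
  apply/eqP; rewrite -(@eqrXn2 _ 2) ?edist_ge0 // edist_row_mx edistxx.
  by rewrite expr0n addr0.
exists (n + 1)%N => m T triT [a [b [c [eT dist]]]] r _ chi.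
rewrite eT in triT; have ab := triangle_base_neq triT.
have [t [dca dcb]] := foot_of_height ab dist.
pose s := edist a b.
have s0 : 0 < s.
  rewrite lt_neqAle edist_ge0 andbT eq_sym; apply: contra_neq ab; exact: edist_eq0.
have [[A [B [dAB nAB]]]|same] :=
    pselect (exists A B, edist A B = s /\ chi A <> chi B); last first.
  left; have {}same A B : edist A B = s -> chi A = chi B.
    move=> dAB; apply: contrapT => nAB; apply: same; by exists A, B.
  have [f Hf] := mono (fun=> true).
  apply: (@monochromatic_copy _ _ _ _ _ x (fun i => io (f i))) => i j.
    by rewrite dio dpt (Hf i j).2.
  by rewrite /io !(constant_on_hyperplane s0 same).
pose e : 'rV[R]_(n + 1) := row_mx 0 (const_mx 1).
have e1 : dotp e e = 1.
  by rewrite dotp_row_mx dotp0l /dotp big_ord1 !mxE mulr1 add0r.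
pose v := s^-1 *: (B - A).
have v1 : dotp v v = 1.
  have -> : dotp v v = s^-1 ^+ 2 * dotp (B - A) (B - A).
    by rewrite /dotp mulr_sumr; apply: eq_bigr => i _; rewrite !mxE; ring.
  by rewrite -edist_sqr edistC dAB -exprMn mulVf ?expr1n // gt_eqF.
have [F [Fe Fsub Fdot]] : exists F : 'rV[R]_(n + 1) -> 'rV[R]_(n + 1),
    [/\ F e = v, forall x y, F x - F y = F (x - y) &
      forall x y, dotp (F x) (F y) = dotp x y].
  exists (reflect_along (v - e)); split; first exact: reflect_along_swap.
    exact: reflect_alongB.
  exact: dotp_reflect_along.
have FB : B - A = s *: F e.
  by rewrite Fe /v scalerA divff ?scale1r // gt_eqF.
have ioe k : dotp (io k) e = 0.
  by rewrite dotp_row_mx dotp0l dotpC dotp0l addr0.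
have nio k : dotp (io k) (io k) = h ^+ 2.
  by rewrite dotp_row_mx npt dotp0l addr0.
(* The sphere of apices: [F] turns the last axis into the direction of [B - A]. *)
pose P k := A + t *: (B - A) + F (io k).
have dPq k q : dotp (F (io k) + q *: (B - A)) (F (io k) + q *: (B - A)) =
    h ^+ 2 + q ^+ 2 * s ^+ 2.
  rewrite FB scalerA dotpDZl !dotpDZr (dotpC (F e) (F (io k))) !Fdot.
  rewrite ioe nio e1.
  ring.
have dPA k : edist (P k) A = edist c a.
  apply/eqP; rewrite -(@eqrXn2 _ 2) ?edist_ge0 // dca (edist_sqr (P k)) -/s -(dPq k); apply/eqP.
  have -> : P k - A = F (io k) + t *: (B - A); last by [].
  by rewrite /P; apply/rowP => i; rewrite !mxE; ring.
have dPB k : edist (P k) B = edist c b.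
  apply/eqP; rewrite -(@eqrXn2 _ 2) ?edist_ge0 // dcb (edist_sqr (P k)) -/s -(sqrrN (1 - t)) opprB -(dPq k).
  have -> : P k - B = F (io k) + (t - 1) *: (B - A); last by [].
  by rewrite /P; apply/rowP => i; rewrite !mxE; ring.
have dPP k k' : edist (P k) (P k') = edist (pt k) (pt k').
  rewrite -dio !edistE; congr Num.sqrt.
  have -> : P k - P k' = F (io k) - F (io k') by rewrite /P opprD addrACA subrr add0r.
  by rewrite Fsub Fdot.
have [[k kA kB]|two] := pselect (exists2 k, chi (P k) <> chi A & chi (P k) <> chi B).
  right; rewrite eT; apply: (@rainbow_copy _ _ _ _ a b c A B (P k)) => //; exact/eqP.
left; have [f Hf] := mono (fun k => chi (P k) == chi A).
apply: (@monochromatic_copy _ _ _ _ _ x (fun i => P (f i))) => i j.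
  by rewrite dPP dpt (Hf i j).2.
have colB k : chi (P k) != chi A -> chi (P k) = chi B.
  by move=> /eqP kA; apply: contrapT => kB; apply: two; exists k.
have := (Hf i j).1; case: eqP => [->|/eqP/colB ->]; first by move/esym/eqP.
by move/esym/negbT/colB.
Qed.

(** ** Rectangular sets *)

Lemma box_vertices_edist (R : realType) (m k : nat) (p : 'rV[R]_m)
    (e : 'I_k -> 'rV[R]_m) (S S' : {set 'I_k}) :
  (forall i j, i != j -> dotp (e i) (e j) = 0) ->
  edist (p + \sum_(i in S) e i) (p + \sum_(i in S') e i) ^+ 2 =
  \sum_l dotp (e l) (e l) * ((l \in S) != (l \in S'))%:R.
Proof.
move=> orth; (* The differences of the coefficients are [0], [1] or [-1]. *)
pose a l : R := (l \in S)%:R - (l \in S')%:R.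
have sumE (X : {set 'I_k}) : \sum_(i in X) e i = \sum_i (i \in X)%:R *: e i.
  rewrite big_mkcond; apply: eq_bigr => i _.
  by case: (i \in X); rewrite ?scale1r ?scale0r.
have dE : p + \sum_(i in S) e i - (p + \sum_(i in S') e i) = \sum_l a l *: e l.
  rewrite opprD addrACA subrr add0r !sumE -sumrB.
  by apply: eq_bigr => i _; rewrite -scalerBl.
have dotsum (b : 'I_k -> R) u : dotp (\sum_l b l *: e l) u = \sum_l b l * dotp (e l) u.
  elim/big_rec2: _ => [|l y z _ <-]; first exact: dotp0l.
  by rewrite addrC dotpDZl addrC.
rewrite edist_sqr dE dotsum; apply: eq_bigr => l _.
rewrite dotpC dotsum (bigD1 l) //= big1 ?addr0 => [|j /orth ->]; last by rewrite mulr0.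
rewrite mulrA mulrC; congr (_ * _); rewrite /a.
by case: (l \in S); case: (l \in S'); rewrite /= ?subrr ?subr0 ?sub0r ?mulr0 ?mulr1 ?mulrNN ?mulr1.
Qed.

Lemma rectangular_sphere_ramsey (R : realType) (d : nat) (X : set 'rV[R]_d) (rho h : R) :
  is_rectangular X -> sphere_radius X rho -> rho < h ->
  exists (I : finType) (x : I -> 'rV[R]_d), X = range x /\
    sphere_ramsey (h ^+ 2) (fun i j => \sum_l (x i 0 l - x j 0 l) ^+ 2).
Proof.
move=> [m [k [p [e [Y [[ne0 orth] YB [f fX fiso]]]]]]] [rho0 [c hc]] rhoh.
pose vert (S : {set 'I_k}) := p + \sum_(i in S) e i.
pose I : finType := {S : {set 'I_k} | `[< Y (vert S) >]}.
have pre (i : I) : exists x, X x /\ f x = vert (val i).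
  have /asboolP : `[< Y (vert (val i)) >] := valP i.
  by move: (vert _) => q; rewrite -fX => -[x Xx <-]; exists x.
have [x Hx] := choice pre.
have iso i j : edist (x i) (x j) = edist (vert (val i)) (vert (val j)).
  have [Xi <-] := Hx i; have [Xj <-] := Hx j; exact/esym/fiso.
have sqE i j : \sum_l (x i 0 l - x j 0 l) ^+ 2 =
    \sum_l dotp (e l) (e l) * ((l \in val i) != (l \in val j))%:R.
  rewrite -(box_vertices_edist p _ _ orth) -iso edist_sqr.
  by apply: eq_bigr => l _; rewrite !mxE expr2.
exists I, x; split.
  apply/seteqP; split=> [y Xy|_ [i _ <-]]; last by have [] := Hx i.
  have Yf : Y (f y) by rewrite -fX; exists y.
  have [S _ eS] := YB _ Yf.
  have YS : `[< Y (vert S) >] by apply/asboolP; rewrite /vert eS.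
  exists (exist _ S YS) => //; have [Xi fi] := Hx (exist _ S YS).
  by apply: edist_eq0; rewrite -fiso // fi /= /vert eS edistxx.
have lam0 l : 0 < dotp (e l) (e l).
  rewrite lt_neqAle dotp_ge0 andbT eq_sym; apply: contra_neq (ne0 l); exact: dotp_eq0.
pose b (i : I) : 'rV[R]_k := \row_l (Num.sqrt (dotp (e l) (e l)) * (l \in val i)%:R).
have bE i j : \sum_l (b i 0 l - b j 0 l) ^+ 2 =
    \sum_l dotp (e l) (e l) * ((l \in val i) != (l \in val j))%:R.
  rewrite -sum_square_indicator; last by move=> l; exact: ltW.
  by apply: eq_bigr => l _; rewrite !mxE.
have [|i|z [s [sb hs]]] := @transport_center R I d k x b c (rho ^+ 2) (sqr_ge0 _).
- by move=> i j; rewrite sqE bE.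
- have [Xi _] := Hx i; rewrite -(hc _ Xi) edist_sqr.
  by apply: eq_bigr => l _; rewrite !mxE expr2.
apply: (@sphere_ramsey_ext R I (h ^+ 2) _ (fun i j =>
  \sum_l dotp (e l) (e l) * ((l \in val i) != (l \in val j))%:R)) => //.
apply: (@sphere_ramsey_box R I k (fun i => val i) _ (fun l => z 0 l) s) => //.
  case/andP: sb => -> /=; move/le_lt_trans; apply.
  by rewrite ltr_pXn2r // nnegrE ?(ltW (le_lt_trans rho0 rhoh)).
by move=> i; rewrite -(hs i); apply: eq_bigr => l _; rewrite mxE.
Qed.

Lemma simplex_sphere_ramsey (R : realType) (d : nat) (X : set 'rV[R]_d) (rho h : R) :
  is_simplex X -> sphere_radius X rho -> rho < h ->
  exists (I : finType) (x : I -> 'rV[R]_d), X = range x /\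
    sphere_ramsey (h ^+ 2) (fun i j => \sum_l (x i 0 l - x j 0 l) ^+ 2).
Proof.
move=> [k [x ind eX]] [rho0 [c hc]] rhoh; exists 'I_k.+1, x; split=> //.
apply: (@sphere_ramsey_simplex _ _ _ x c (rho ^+ 2)) => //.
  by rewrite sqr_ge0 /= ltr_pXn2r // nnegrE ?(ltW (le_lt_trans rho0 rhoh)).
move=> i; rewrite -(hc (x i)); last by rewrite eX; exists i.
by rewrite edist_sqr; apply: eq_bigr => l _; rewrite !mxE expr2.
Qed.

Theorem corollary1p5 (R : realType) :
  (forall (h : R) (d : nat) (X : set 'rV[R]_d),
     is_rectangular X \/ is_simplex X ->
     (exists2 rho : R, is_circumradius X rho & rho < h) ->
     exists n : nat,
       forall (m : nat) (T : set 'rV[R]_m),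
         is_triangle T -> has_height T h ->
         forall r : nat, (0 < r)%N -> gr_arrow n r X T) /\
  (forall (h : R) (d : nat) (T : set 'rV[R]_d),
     is_triangle T -> has_height T h ->
     (exists2 rho : R, is_circumradius T rho & rho < h) ->
     exists n : nat,
       forall r : nat, (0 < r)%N -> gr_arrow n r T T).
Proof.
have main (h : R) (d : nat) (X : set 'rV[R]_d) :
     is_rectangular X \/ is_simplex X ->
     (exists2 rho : R, is_circumradius X rho & rho < h) ->
     exists n : nat,
       forall (m : nat) (T : set 'rV[R]_m),
         is_triangle T -> has_height T h ->
         forall r : nat, (0 < r)%N -> gr_arrow n r X T.
  move=> rs [rho [sph _] rhoh].
  have h0 : 0 < h by apply: le_lt_trans rhoh; case: sph.
  have [I [x [-> SR]]] : exists (I : finType) (x : I -> 'rV[R]_d), X = range x /\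
      sphere_ramsey (h ^+ 2) (fun i j => \sum_l (x i 0 l - x j 0 l) ^+ 2).
    by case: rs => [/rectangular_sphere_ramsey|/simplex_sphere_ramsey]; apply; eauto.
  exact: sphere_ramsey_gr_arrow SR.
split=> // h d T triT hT circ.
have [n Hn] := main h d T (or_intror (ex_intro _ 2%N triT)) circ.
by exists n => r; exact: Hn.
Qed.
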